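(* Let $C=C_{\{\mathcal{I}_n,\mathcal{J}_n\}}$ be a nice Cantor set which is $(\alpha_n)$-porous for some sequence $(\alpha_n)_{n\ge1}$, $0<\alpha_n<1$, such that $\sum_{n}\alpha_n^p=\infty$ for some $0<p<\infty$. Then there is a doubling measure $\mu$ on $\mathbb{R}$ with $\mu(C)=0$.
   Context: A measure means a Borel regular outer measure; $\mu$ on $\mathbb{R}$ is doubling if there is $c<\infty$ with $0<\mu(B(x,2r))\le c\,\mu(B(x,r))<\infty$ for all $x$, $r>0$. A Cantor construction $\{\mathcal{I}_n,\mathcal{J}_n\}_n$: for each $n\in\mathbb{N}$, $\mathcal{I}_n=\{I_{n,i}\}_i$ is a collection of closed intervals with mutually disjoint interiors and $\mathcal{J}_n=\{J_{n,i}\}_i$ a collection of open intervals with $J_{n,i}\subset I_{n,i}$, such that each $I_{n+1,i}$ is contained in some $I_{n,j}$, $\bigcup\mathcal{I}_{n+1}=\bigcup\mathcal{I}_n\setminus\bigcup\mathcal{J}_n$, $\sup_j|I_{n,j}|\to0$, and $\bigcup\mathcal{I}_1$ is bounded; $C=\bigcap_n\bigcup_iI_{n,i}$. Nice: there is $0<c<1$ with $cI_{n,i}\cap J_{n,i}\neq\emptyset$ for all $n,i$ ($cI$ the interval concentric with $I$ of length $c|I|$). $(\alpha_n)$-porous: $|J_{n,i}|\ge\alpha_n|I_{n,i}|$ for all $n,i$. *)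

(* Defs.v *)
From HB Require Import structures.
From mathcomp Require Import all_boot all_order all_algebra.
From mathcomp Require Import all_classical all_reals all_analysis.
Set Implicit Arguments. Unset Strict Implicit. Unset Printing Implicit Defensive.
Import Order.TTheory GRing.Theory Num.Theory.
Import numFieldNormedType.Exports.
Local Open Scope classical_set_scope.
Local Open Scope ring_scope.

(* Levels n = 1,2,3,... of the paper are indexed by n = 0,1,2,... here.
   At level n the collection I_n is {[a n i, b n i] | i in idx n} and
   J_n is {]c n i, d n i[ | i in idx n}. *)

Section Defs.
Variable R : realType.

Definition Iint (a b : nat -> nat -> R) n i : set R := `[a n i, b n i].
Definition Jint (c d : nat -> nat -> R) n i : set R := `]c n i, d n i[.

Definition cantor_construction (idx : nat -> set nat)
    (a b c d : nat -> nat -> R) : Prop :=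
      (forall n i, idx n i -> a n i <= b n i) /\
      (forall n i j, idx n i -> idx n j -> i <> j ->
          `]a n i, b n i[ `&` `]a n j, b n j[ = set0) /\
      (forall n i, idx n i -> Jint c d n i `<=` Iint a b n i) /\
      (forall n i, idx n.+1 i ->
          exists j, idx n j /\ Iint a b n.+1 i `<=` Iint a b n j) /\
      (forall n, \bigcup_(i in idx n.+1) Iint a b n.+1 i =
          (\bigcup_(i in idx n) Iint a b n i) `\` (\bigcup_(i in idx n) Jint c d n i)) /\
      (forall e : R, 0 < e -> exists N, forall n, (N <= n)%N ->
          forall i, idx n i -> b n i - a n i <= e) /\
      (exists M : R, forall i x, idx 0%N i -> Iint a b 0%N i x -> `|x| <= M).

Definition cantor_set (idx : nat -> set nat) (a b : nat -> nat -> R) : set R :=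
  \bigcap_(n in [set: nat]) \bigcup_(i in idx n) Iint a b n i.

Definition concentric_scale (s : R) (a b : nat -> nat -> R) n i : set R :=
  `[(a n i + b n i) / 2 - s * (b n i - a n i) / 2,
    (a n i + b n i) / 2 + s * (b n i - a n i) / 2].

Definition nice_construction (idx : nat -> set nat) (a b c d : nat -> nat -> R) :=
  exists s : R, 0 < s < 1 /\
    forall n i, idx n i -> concentric_scale s a b n i `&` Jint c d n i !=set0.

Definition porous_construction (alpha : nat -> R) (idx : nat -> set nat)
    (a b c d : nat -> nat -> R) :=
  forall n i, idx n i -> alpha n * (b n i - a n i) <= d n i - c n i.

Definition borel_regular (mu : {outer_measure set R -> \bar R}) :=
  (forall A : set R, measurable A -> mu.-caratheodory A) /\
  (forall A : set R, exists B : set R, [/\ measurable B, A `<=` B & mu A = mu B]).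

Definition doubling (mu : {outer_measure set R -> \bar R}) :=
  exists C : R, forall (x r : R), 0 < r ->
    [/\ (0 < mu (ball x (2 * r)))%E,
        (mu (ball x (2 * r)) <= C%:E * mu (ball x r))%E &
        (C%:E * mu (ball x r) < +oo)%E].

End Defs.

(* Main.v *)
(* It suffices to find a doubling measure [mu] with [mu J >= k * alpha_n ^ p * mu I] for every
   interval [I = I_(n,i)] and its gap [J]: then the gaps of level [n] carry a proportion at least
   [k * alpha_n ^ p] of the mass of the level, hence of the mass of [C], and the gaps are disjoint.

   Pick a point [z] in [J], well inside [I] (niceness) and well inside [J]. Since later intervals
   avoid [J], two such points satisfy [|z - z'| >= const * min(|I|, |I'|)]. This separation lets one
   cut the line, recursively, into M-adic cells whose end points are all far from every [z] at the
   relevant scale, and shows that a cell [Q] much shorter than [I] contains at most one such [z].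
   When [Q] is cut into [M] children, the two outer children keep the density of [Q], the child
   containing [z] gets all the remaining mass, up to a small proportion, and if there is no such [z]
   the mass is spread uniformly. For [M] large the mass of the child containing [z] is at least
   [(|child| / |Q|) ^ p] times the mass of [Q], which after iteration gives the bound on [mu J].
   Since outer children keep the density of their parent, the densities of two adjacent cells remain
   comparable in all generations (Kakutani's trick), so [mu] is doubling. *)
Require Import Defs.
From HB Require Import structures.
From mathcomp Require Import all_boot all_order all_algebra.
From mathcomp Require Import all_classical all_reals all_analysis.
From mathcomp Require Import ring lra zify.
Import Order.TTheory GRing.Theory Num.Theory.
Import numFieldNormedType.Exports.
Local Open Scope classical_set_scope.
Local Open Scope ring_scope.

(** * Points far from the centres of the gaps *)

Section GoodPoints.
Variables (R : realType) (E : R -> R -> Prop) (delta : R).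
Hypotheses (delta0 : 0 < delta) (delta1 : delta <= 1).
Hypothesis Epos : forall z l, E z l -> 0 < l.
Hypothesis Esep : forall z l z' l', E z l -> E z' l' -> z <> z' ->
  2 * delta * Num.min l l' <= `|z - z'|.

(* A closed interval of radius [r] contains at most one of the points of size more than [m], so one
   of its two halves has a subinterval of radius [r / 4] away from all of them. *)
Lemma avoid_large_points (x r m : R) : 0 < r -> r < delta * m ->
  exists y, `|y - x| <= r / 2 /\
    forall w z l, `|w - y| <= r / 4 -> E z l -> m <= l -> r / 4 <= `|w - z|.
Proof.
move=> r0 rm; case: (pselect (exists z l, [/\ E z l, m <= l & x <= z <= x + r])).
- case=> z0 [l0] [Ez0 ml0 xz0]; exists (x - r / 2); split.
    by rewrite ler_distl; apply/andP; split; lra.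
  move=> w z l; rewrite ler_distl => wy Ezl ml; rewrite ler_normr.
  case: (pselect (z = z0)) => [->|zz0]; first by apply/orP; right; lra.
  have := Esep _ _ _ _ Ezl Ez0 zz0.
  have : delta * m <= delta * Num.min l l0 by rewrite ler_pM2l // le_min ml ml0.
  rewrite -mulrA; set t := delta * Num.min _ _ => mt.
  by rewrite ler_normr => /orP[] h; apply/orP; first [by right; lra | by left; lra].
- move=> no; exists (x + r / 2); split.
    by rewrite ler_distl; apply/andP; split; lra.
  move=> w z l; rewrite ler_distl => wy Ezl ml; rewrite ler_normr; apply/orP.
  case: (lerP x z) => zx; last by left; lra.
  case: (lerP z (x + r)) => zxr; last by right; lra.
  by case: no; exists z, l; split => //; rewrite zx zxr.
Qed.

(** Nested intervals of radius [r k] close in on [u]. Stage [k] clears all points of size at least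
    [eta / 4 ^+ k.+1], so each point is cleared at a stage matching its own size. *)
Lemma exists_good_point (t eta : R) : 0 < eta ->
  exists u, `|u - t| <= eta /\
    forall z l, E z l -> delta / 32 * Num.min l eta <= `|u - z|.
Proof.
move=> eta0.
(* The factor [1 / 8] gives [r k < delta * (eta / 4 ^+ k.+1)], as [avoid_large_points] requires; the
   ratio [4] makes its ball of radius [r k / 4] the next interval. *)
pose r (k : nat) := delta * eta / 8 / 4 ^+ k.
have r0 k : 0 < r k by rewrite !divr_gt0 ?mulr_gt0 ?exprn_gt0.
have rS k : r k.+1 = r k / 4 by rewrite /r exprS invfM; ring.
have step (k : nat) (x : R) : exists y, `|y - x| <= r k / 2 /\
    forall w z l, `|w - y| <= r k / 4 -> E z l -> eta / 4 ^+ k.+1 <= l ->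
      r k / 4 <= `|w - z|.
  apply: avoid_large_points => //; rewrite /r exprS invfM.
  have : 0 < delta * eta / 4 ^+ k by rewrite divr_gt0 ?mulr_gt0 ?exprn_gt0.
  set A := (4 ^+ k)^-1; have -> : delta * eta / 8 * A = delta * eta * A / 8 by ring.
  have -> : delta * (eta * (4^-1 * A)) = delta * eta * A / 4 by ring.
  lra.
pose f k := projT1 (choice (step k)).
have fP k : forall x, _ := projT2 (choice (step k)).
pose x := fix x k := if k is k'.+1 then f k' (x k') else t.
have xS k : `|x k.+1 - x k| <= r k / 2 by case: (fP k (x k)).
have lo k : x k - r k <= x k.+1 - r k.+1 by have := xS k; rewrite rS ler_distl; have := r0 k; lra.
have hi k : x k.+1 + r k.+1 <= x k + r k by have := xS k; rewrite rS ler_distl; have := r0 k; lra.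
have lo_mono k j : x k - r k <= x (k + j)%N - r (k + j)%N.
  by elim: j => [|j IH]; rewrite ?addn0 // addnS; apply: le_trans IH (lo _).
have hi_mono k j : x (k + j)%N + r (k + j)%N <= x k + r k.
  by elim: j => [|j IH]; rewrite ?addn0 // addnS; apply: le_trans (hi _) IH.
have lohi k j : x k - r k <= x j + r j.
  have := lo_mono k j; have := hi_mono j k; rewrite addnC; have := r0 (k + j)%N; lra.
pose S := [set v | exists k, v = x k - r k]%classic.
have S0 : (S !=set0)%classic by exists (x 0%N - r 0%N), 0%N.
have hS j : ubound S (x j + r j) by move=> _ [k ->].
pose u := sup S.
have ulo k : x k - r k <= u.
  by apply: ub_le_sup; [exists (x 0%N + r 0%N) | exists k].
have uhi k : u <= x k + r k by apply: ge_sup.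
exists u; split.
  have := ulo 0%N; have := uhi 0%N; rewrite ler_distl /= /r expr0 divr1.
  have : delta * eta <= eta by rewrite ler_piMl // ltW.
  lra.
move=> z l Ezl; have l0 := Epos _ _ Ezl.
pose m := Num.min l eta.
have m0 : 0 < m by rewrite lt_min l0 eta0.
have ml : m <= l by rewrite ge_min lexx.
(* Stage [k] clears [z] at distance [r k / 4 = delta / 32 * (eta / 4 ^+ k)], which is at least
   [delta / 32 * m]. *)
have [k k_le k_gt] : exists2 k, eta / 4 ^+ k.+1 <= m & m <= eta / 4 ^+ k.
  pose P k := eta / 4 ^+ k.+1 <= m.
  have exP : exists k, P k.
    exists (Num.bound (eta / m)); rewrite /P.
    rewrite ler_pdivrMr ?exprn_gt0 // mulrC -ler_pdivrMr //.
    have /ltW h := archi_boundP (divr_ge0 (ltW eta0) (ltW m0)).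
    apply: (le_trans h); rewrite -natrX ler_nat.
    apply: (@leq_trans (4 ^ Num.bound (eta / m))%N); first exact/ltnW/ltn_expl.
    by rewrite leq_exp2l.
  case: (ex_minnP exP) => k Pk kmin; exists k => //.
  case: k Pk kmin => [|k] Pk kmin; first by rewrite expr0 divr1 ge_min lexx orbT.
  rewrite leNgt; apply/negP => /ltW kk; have := kmin k kk; by rewrite ltnn.
have [_ /(_ u z l)] := fP k (x k).
have uk : `|u - f k (x k)| <= r k / 4.
  by rewrite -rS ler_distl; apply/andP; split; [exact: (ulo k.+1)|exact: (uhi k.+1)].
move=> /(_ uk Ezl (le_trans k_le ml)); apply: le_trans.
rewrite -/m /r.
have -> : delta * eta / 8 / 4 ^+ k / 4 = delta / 32 * (eta / 4 ^+ k).
  by set A := (4 ^+ k)^-1; field.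
by rewrite ler_pM2l // divr_gt0.
Qed.

End GoodPoints.

(** * Doubling cumulative functions from trees of intervals *)

Lemma exists_expr_le (R : realType) (c eps T : R) : 0 < c <= 1 -> 0 < eps -> 0 < T ->
  exists k, (1 - c) ^+ k * T <= eps.
Proof.
move=> /andP[c0 c1] eps0 T0.
have bernoulli k : (1 - c) ^+ k * (1 + k%:R * c) <= 1.
  elim: k => [|k IH]; first by rewrite expr0 mul0r addr0 mul1r.
  apply: le_trans IH; rewrite exprSr -mulrA ler_wpM2l ?exprn_ge0 ?subr_ge0 //.
  by rewrite -natr1; have : 0 <= k%:R :> R by []; nra.
pose n := Num.bound (T / (c * eps)); exists n.
have nT : T <= (1 + n%:R * c) * eps.
  have : T / (c * eps) < n%:R.
    by apply: archi_boundP; rewrite divr_ge0 ?mulr_ge0 // ltW.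
  by rewrite ltr_pdivrMr ?mulr_gt0 // => h; nra.
have x0 : 0 <= (1 - c) ^+ n by rewrite exprn_ge0 // subr_ge0.
apply: (le_trans (ler_wpM2l x0 nT)); rewrite mulrA.
by rewrite -[leRHS]mul1r ler_pM2r.
Qed.

Lemma int_divP (M : nat) (i : int) : (0 < M)%N ->
  exists (a : int) (b : nat), (b < M)%N /\ i = a * M%:Z + b%:Z.
Proof.
move=> M_gt0; exists (i %/ M)%Z, `|(i %% M)%Z|%N; have M0 : (M%:Z != 0) by lia.
split; last by rewrite gez0_abs ?modz_ge0 // -divz_eq.
by rewrite -ltz_nat gez0_abs ?modz_ge0 // ltz_pmod //; lia.
Qed.

(* [S u v b] is the [b]-th of the points cutting [[u, v]] into [M] children, and [G u v b - u] is the
   mass of [[u, S u v b]] when [[u, v]] has density [1]. By the last two fields the outer children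
   keep the density of their parent. *)
Record split_rule (R : realType) (M : nat) (K : R) (S G : R -> R -> nat -> R) : Prop :=
  SplitRule {
    rule_M3 : (3 <= M)%N;
    rule_K2 : 2 <= K;
    rule_S0 : forall u v, S u v 0 = u;
    rule_SM : forall u v, S u v M = v;
    rule_G0 : forall u v, G u v 0 = u;
    rule_GM : forall u v, G u v M = v;
    rule_Slen : forall u v b, u < v -> (b < M)%N ->
      (v - u) / K <= S u v b.+1 - S u v b <= (v - u) / 2;
    rule_Glen : forall u v b, u < v -> (b < M)%N ->
      (S u v b.+1 - S u v b) / K <= G u v b.+1 - G u v b <= K * (S u v b.+1 - S u v b);
    rule_G1 : forall u v, u < v -> G u v 1 = S u v 1;
    rule_GM1 : forall u v, u < v -> G u v M.-1 = S u v M.-1 }.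

Section Tree.
Context {R : realType} {M : nat} {K T t0 : R} {S G : R -> R -> nat -> R}.

(* The [i]-th end point of the cells of generation [k], and the value there of the cumulative
   function of the measure being constructed. *)
Fixpoint grid (k : nat) (i : int) : R * R :=
  if k is k'.+1 then
    let p := grid k' (i %/ M)%Z in
    let q := grid k' ((i %/ M)%Z + 1) in
    let b := `|(i %% M)%Z|%N in
    (S p.1 q.1 b, p.2 + (q.2 - p.2) / (q.1 - p.1) * (G p.1 q.1 b - p.1))
  else (t0 + i%:~R * T, t0 + i%:~R * T).

Definition node k i := (grid k i).1.
Definition nmass k i := (grid k i).2.
Definition clen k i := node k (i + 1) - node k i.
Definition dens k i := (nmass k (i + 1) - nmass k i) / clen k i.

Hypotheses (rule : split_rule R M K S G) (T0 : 0 < T).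
Let M3 := rule_M3 _ _ _ _ _ rule.
Let K2 := rule_K2 _ _ _ _ _ rule.
Let S0 := rule_S0 _ _ _ _ _ rule.
Let SM := rule_SM _ _ _ _ _ rule.
Let G0 := rule_G0 _ _ _ _ _ rule.
Let GM := rule_GM _ _ _ _ _ rule.
Let Slen := rule_Slen _ _ _ _ _ rule.
Let Glen := rule_Glen _ _ _ _ _ rule.
Let G1 := rule_G1 _ _ _ _ _ rule.
Let GM1 := rule_GM1 _ _ _ _ _ rule.

(** * Lengths, masses and densities of the cells *)

Lemma K_gt0 : 0 < K. Proof. by apply: lt_le_trans K2. Qed.

Lemma K_ge1 : 1 <= K. Proof. by apply: le_trans K2; rewrite ler1n. Qed.

Let M_gt0 : (0 < M)%N := ltnW (ltnW M3).

Lemma grid_lt k a (b : nat) : (b < M)%N ->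
  node k.+1 (a * M%:Z + b%:Z) = S (node k a) (node k (a + 1)) b /\
  nmass k.+1 (a * M%:Z + b%:Z)
    = nmass k a + dens k a * (G (node k a) (node k (a + 1)) b - node k a).
Proof.
move=> bM; have M0 : M%:Z != 0 by lia.
rewrite /node /nmass /= divzMDl // (divz_small (m := b%:Z)); last by lia.
by rewrite addr0 modzMDl modz_small //; lia.
Qed.

Lemma node_lt k i : node k i < node k (i + 1).
Proof.
elim: k i => [|k IH] i; first by rewrite /node /= intrD ltrD2l ltr_pM2r // ltrDl.
have [a [b [bM ->]]] := int_divP M i M_gt0.
have [-> _] := grid_lt k a b bM.
have lt : S (node k a) (node k (a + 1)) b < S (node k a) (node k (a + 1)) b.+1.
  have /andP[+ _] := Slen _ _ _ (IH a) bM.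
  have : 0 < (node k (a + 1) - node k a) / K by rewrite divr_gt0 ?subr_gt0 // K_gt0.
  lra.
apply: (lt_le_trans lt); rewrite -addrA.
case: (ltnP b.+1 M) => bM1.
  have -> : b%:Z + 1 = b.+1%:Z by lia.
  by have [-> _] := grid_lt k a _ bM1.
have bM' : b.+1 = M by lia.
rewrite bM' SM; have -> : a * M%:Z + (b%:Z + 1) = (a + 1) * M%:Z + 0%N%:Z by lia.
by have [-> _] := grid_lt k (a + 1) 0%N (leq_trans (ltn0Sn _) M3); rewrite S0.
Qed.

Lemma clen_gt0 k i : 0 < clen k i. Proof. by rewrite subr_gt0 node_lt. Qed.

Lemma nmass_incr k i : nmass k (i + 1) - nmass k i = dens k i * clen k i.
Proof. by rewrite /dens divfK // gt_eqF // clen_gt0. Qed.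

(** For [b = M] the point is the first one of the next cell [a + 1]. Allowing it expresses both ends
    of every child through one parent. *)
Lemma grid_le k a (b : nat) : (b <= M)%N ->
  node k.+1 (a * M%:Z + b%:Z) = S (node k a) (node k (a + 1)) b /\
  nmass k.+1 (a * M%:Z + b%:Z)
    = nmass k a + dens k a * (G (node k a) (node k (a + 1)) b - node k a).
Proof.
rewrite leq_eqVlt => /orP[/eqP->|]; last exact: grid_lt.
have -> : a * M%:Z + M%:Z = (a + 1) * M%:Z + 0%N%:Z by lia.
have [-> ->] := grid_lt k (a + 1) 0%N (leq_trans (ltn0Sn _) M3).
rewrite S0 SM G0 GM subrr mulr0 addr0 -/(clen k a) -nmass_incr; split => //; ring.
Qed.

Lemma grid_child k a : node k.+1 (a * M%:Z) = node k a /\ nmass k.+1 (a * M%:Z) = nmass k a.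
Proof.
have := grid_le k a 0%N (leq0n _); rewrite addr0 S0 G0 subrr mulr0 addr0.
by case.
Qed.

Lemma clen_child k a (b : nat) : (b < M)%N ->
  clen k.+1 (a * M%:Z + b%:Z) =
    S (node k a) (node k (a + 1)) b.+1 - S (node k a) (node k (a + 1)) b.
Proof.
move=> bM; rewrite /clen -(addrA (a * M%:Z)); have -> : b%:Z + 1 = b.+1%:Z by lia.
by have [-> _] := grid_le k a _ (ltnW bM); have [-> _] := grid_le k a _ bM.
Qed.

Lemma nmass_child k a (b : nat) : (b < M)%N ->
  nmass k.+1 (a * M%:Z + b%:Z + 1) - nmass k.+1 (a * M%:Z + b%:Z) =
  dens k a * (G (node k a) (node k (a + 1)) b.+1 - G (node k a) (node k (a + 1)) b).
Proof.
move=> bM; rewrite -(addrA (a * M%:Z)); have -> : b%:Z + 1 = b.+1%:Z by lia.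
have [_ ->] := grid_le k a _ (ltnW bM); have [_ ->] := grid_le k a _ bM; ring.
Qed.

Lemma clen_child_bounds k a (b : nat) : (b < M)%N ->
  clen k a / K <= clen k.+1 (a * M%:Z + b%:Z) <= clen k a / 2.
Proof. by move=> bM; rewrite clen_child //; apply: Slen => //; exact: node_lt. Qed.

Lemma dens0 i : dens 0 i = 1.
Proof. by rewrite /dens /clen /nmass /node /= divff // gt_eqF // -[X in 0 < X]/(clen 0 i) clen_gt0. Qed.

Lemma dens_gt0 k i : 0 < dens k i.
Proof.
elim: k i => [|k IH] i; first by rewrite dens0.
have [a [b [bM ->]]] := int_divP M i M_gt0.
rewrite divr_gt0 ?clen_gt0 // nmass_child // mulr_gt0 //.
have /andP[+ _] := Glen _ _ _ (node_lt k a) bM; apply: lt_le_trans.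
by rewrite divr_gt0 ?K_gt0 // -clen_child // clen_gt0.
Qed.

Lemma dens_child k a (b : nat) : (b < M)%N ->
  dens k a / K <= dens k.+1 (a * M%:Z + b%:Z) <= K * dens k a.
Proof.
move=> bM; have /andP[lo hi] := Glen _ _ _ (node_lt k a) bM.
rewrite {2 3}/dens nmass_child // ler_pdivlMr ?clen_gt0 // ler_pdivrMr ?clen_gt0 //.
rewrite clen_child //; apply/andP; split.
  rewrite -mulrA [K^-1 * _]mulrC.
  by rewrite ler_pM2l // dens_gt0.
by rewrite (mulrC K) -(mulrA (dens k a)) ler_pM2l // dens_gt0.
Qed.

Lemma dens_first k a : dens k.+1 (a * M%:Z) = dens k a.
Proof.
have M0 : (0 < M)%N by lia.
have := nmass_child k a _ M0; have := clen_child k a _ M0; rewrite /dens addr0 => -> ->.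
rewrite G0 S0 G1 ?node_lt // mulfK // gt_eqF // -[X in _ - X](S0 _ (node k (a + 1))).
by rewrite -clen_child // clen_gt0.
Qed.

Lemma dens_last k a : dens k.+1 (a * M%:Z + M.-1%:Z) = dens k a.
Proof.
have M0 : (M.-1 < M)%N by lia.
have lenE := clen_child k a _ M0.
rewrite {1}/dens nmass_child // (ltn_predK M3) GM GM1 ?node_lt //.
rewrite (ltn_predK M3) SM in lenE.
by rewrite -lenE mulfK // gt_eqF // clen_gt0.
Qed.

Lemma nmass_lt k i : nmass k i < nmass k (i + 1).
Proof. by rewrite -subr_gt0 nmass_incr mulr_gt0 ?dens_gt0 ?clen_gt0. Qed.

Lemma int_seq_le (f : int -> R) : (forall i, f i < f (i + 1)) ->
  forall i j, i <= j -> f i <= f j.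
Proof.
move=> flt i j ij; have -> : j = i + `|j - i|%N%:Z by lia.
elim: `|j - i|%N => [|n IH]; first by rewrite addr0.
apply: (le_trans IH); have -> : i + n.+1%:Z = i + n%:Z + 1 by lia.
exact: ltW.
Qed.

Lemma int_seq_le_inv (f : int -> R) : (forall i, f i < f (i + 1)) ->
  forall i j, f i <= f j -> i <= j.
Proof.
move=> flt i j ij; rewrite leNgt; apply/negP => ji.
have : f (j + 1) <= f i by apply: int_seq_le => //; lia.
by move=> /(lt_le_trans (flt j)) /lt_le_trans /(_ ij); rewrite ltxx.
Qed.

Lemma grid_lift k n i : node (n + k) (i * M%:Z ^+ n) = node k i /\
  nmass (n + k) (i * M%:Z ^+ n) = nmass k i.
Proof.
elim: n => [|n [IH1 IH2]]; first by rewrite expr0 mulr1.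
by rewrite exprSr mulrA addSn; have [-> ->] := grid_child (n + k) (i * M%:Z ^+ n).
Qed.

(** Both nodes are also nodes of generation [k + k'], where positions and masses increase with the
    index. *)
Lemma nmass_mono k i k' i' : node k i <= node k' i' -> nmass k i <= nmass k' i'.
Proof.
have [<- <-] := grid_lift k k' i; have [<- <-] := grid_lift k' k i'.
rewrite (addnC k) => h; apply: (int_seq_le _ (nmass_lt _)).
exact: (int_seq_le_inv _ (node_lt _)) h.
Qed.

Lemma locate_child k a x : node k a <= x < node k (a + 1) -> exists b : nat, (b < M)%N /\
  node k.+1 (a * M%:Z + b%:Z) <= x < node k.+1 (a * M%:Z + b%:Z + 1).
Proof.
move=> /andP[ax xa]; pose f b := S (node k a) (node k (a + 1)) b.
have [b bM /andP[bx xb]] : exists2 b, (b < M)%N & f b <= x < f b.+1.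
  have exb : exists b, x < f b.+1 by exists M.-1; rewrite /f (ltn_predK M3) SM.
  exists (ex_minn exb); case: ex_minnP => b xb bmin.
    by have := bmin M.-1; rewrite /f (ltn_predK M3) SM => /(_ xa); have := M3; lia.
  rewrite xb andbT; case: b xb bmin => [|b] xb bmin; first by rewrite /f S0.
  by rewrite leNgt; apply/negP => /bmin; rewrite ltnn.
exists b; split=> //; rewrite -(addrA (a * M%:Z)).
have -> : b%:Z + 1 = b.+1%:Z by lia.
have [-> _] := grid_le k a _ (ltnW bM); have [-> _] := grid_le k a _ bM.
by rewrite bx.
Qed.

Lemma locate k x : exists i, node k i <= x < node k (i + 1).
Proof.
elim: k => [|k [a xa]].
  exists (Num.floor ((x - t0) / T)); rewrite /node /=.
  have /andP[h1 h2] := floor_itv ((x - t0) / T).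
  by move: h1 h2; rewrite ler_pdivlMr // ltr_pdivrMr //; move=> h1 h2; apply/andP; split; lra.
by have [b [_ xb]] := locate_child k a x xa; exists (a * M%:Z + b%:Z).
Qed.

(** * The cumulative function: monotonicity and right continuity *)

(** The monotone extension of [nmass] from the nodes of all generations to the whole line. *)
Definition cumul (x : R) := sup [set y | exists k i, node k i <= x /\ y = nmass k i]%classic.

Lemma cumul_cell k i x : node k i <= x <= node k (i + 1) ->
  nmass k i <= cumul x <= nmass k (i + 1).
Proof.
move=> /andP[ix xi]; apply/andP; split.
  apply: ub_le_sup; last by exists k, i.
  by exists (nmass k (i + 1)) => _ [k' [i' [ki ->]]]; apply: nmass_mono; apply: le_trans xi.
apply: ge_sup; first by exists (nmass k i), k, i.
by move=> _ [k' [i' [ki ->]]]; apply: nmass_mono; apply: le_trans xi.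
Qed.

Lemma cumul_node k i : cumul (node k i) = nmass k i.
Proof.
apply/eqP; rewrite eq_le.
have /andP[_] : nmass k (i - 1) <= cumul (node k i) <= nmass k (i - 1 + 1).
  apply: cumul_cell; rewrite subrK lexx andbT.
  by have := node_lt k (i - 1); rewrite subrK => /ltW.
rewrite subrK => ->.
by have /andP[->] : nmass k i <= cumul (node k i) <= nmass k (i + 1)
  by apply: cumul_cell; rewrite lexx ltW // node_lt.
Qed.

Lemma cumul_le x y : x <= y -> cumul x <= cumul y.
Proof.
move=> xy; have [i /andP[ix xi]] := locate 0 x; have [j /andP[jy yj]] := locate 0 y.
apply: ge_sup; first by exists (nmass 0 i), 0%N, i.
move=> _ [k [a [ax ->]]]; apply: ub_le_sup; last first.
  by exists k, a; split => //; apply: le_trans xy.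
exists (nmass 0 (j + 1)) => _ [k' [i' [ki ->]]]; apply: nmass_mono.
by apply: le_trans ki _; apply: ltW.
Qed.

Lemma G_mono u v b c : u < v -> (b <= c <= M)%N -> G u v b <= G u v c.
Proof.
move=> uv /andP[bc]; have -> : c = (b + (c - b))%N by lia.
elim: (c - b)%N => [|n IH] bn; first by rewrite addn0.
rewrite addnS in bn *; apply: (le_trans (IH (ltnW bn))).
have /andP[g _] := Glen _ _ _ uv bn; have /andP[s _] := Slen _ _ _ uv bn.
rewrite -subr_ge0; apply: le_trans g; rewrite divr_ge0 ?(ltW K_gt0) //.
apply: le_trans s; by rewrite divr_ge0 ?(ltW K_gt0) // subr_ge0 ltW.
Qed.

(** The first child keeps the density of its parent on a fraction of its length between [1 / K] and
    [1 / 2]. Any other child misses that mass, and the first has at most half of the total, hence at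
    most [1 - K^-1] since [2 <= K]. The resulting decay excludes atoms. *)
Lemma nmass_incr_child k a (b : nat) : (b < M)%N ->
  nmass k.+1 (a * M%:Z + b%:Z + 1) - nmass k.+1 (a * M%:Z + b%:Z)
   <= (1 - K^-1) * (nmass k (a + 1) - nmass k a).
Proof.
move=> bM; rewrite nmass_child // nmass_incr mulrCA ler_pM2l ?dens_gt0 //.
have M0 : (0 < M)%N by lia.
have uv := node_lt k a.
have Kh : K^-1 <= 2^-1 by rewrite lef_pV2 ?posrE ?K_gt0.
have /andP[lo hi] := Slen _ _ _ uv M0.
have l0 := clen_gt0 k a.
rewrite S0 -/(clen k a) in lo hi.
have hK : clen k a * K^-1 <= clen k a * 2^-1 by rewrite ler_pM2l.
case: (posnP b) => [->|b0]; first by rewrite G0 G1 //; lra.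
have : G (node k a) (node k (a + 1)) 1 <= G (node k a) (node k (a + 1)) b.
  by apply: G_mono => //; rewrite b0 ltnW.
have : G (node k a) (node k (a + 1)) b.+1 <= G (node k a) (node k (a + 1)) M.
  by apply: G_mono => //; rewrite bM leqnn.
rewrite GM G1 // => h1 h2.
have lenE : clen k a = node k (a + 1) - node k a by [].
lra.
Qed.

Lemma nmass_incr_le k i : nmass k (i + 1) - nmass k i <= (1 - K^-1) ^+ k * T.
Proof.
elim: k i => [|k IH] i; first by rewrite expr0 mul1r /nmass /= intrD; lra.
have [a [b [bM ->]]] := int_divP M i M_gt0.
apply: (le_trans (nmass_incr_child k a b bM)); rewrite exprS -mulrA.
apply: ler_wpM2l (IH a).
by rewrite subr_ge0 invf_le1 ?K_gt0 // K_ge1.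
Qed.

Lemma cumul_right_cont x eps : 0 < eps -> exists2 d, 0 < d &
  forall y, x <= y < x + d -> cumul y - cumul x <= eps.
Proof.
move=> eps0.
have [k hk] : exists k, (1 - K^-1) ^+ k * T <= eps.
  by apply: exists_expr_le => //; rewrite invr_gt0 K_gt0 invf_le1 ?K_gt0 // K_ge1.
have [i /andP[ix xi]] := locate k x.
exists (node k (i + 1) - x); first by rewrite subr_gt0.
move=> y /andP[xy yx].
have /andP[lo _] : nmass k i <= cumul x <= nmass k (i + 1).
  by apply: cumul_cell; rewrite ix ltW.
have /andP[_ hi] : nmass k i <= cumul y <= nmass k (i + 1).
  by apply: cumul_cell; apply/andP; split; lra.
have := nmass_incr_le k i; lra.
Qed.


(** * Chains of cells of comparable length, and doubling *)

(** A stopping condition: a cell of length at most [s] with a parent longer than [s] has length at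
    least [s / K]. At generation [0] it holds vacuously, and [s < T] makes the cell itself longer
    than [s]. *)
Definition parent_gt (s : R) k (i : int) := if k is k'.+1 then s < clen k' (i %/ M)%Z else True.

Lemma parent_gt_child s k a (b : nat) : (b < M)%N ->
  parent_gt s k.+1 (a * M%:Z + b%:Z) = (s < clen k a).
Proof.
by move=> bM; rewrite /= divzMDl ?(divz_small (m := b%:Z)) ?addr0 //; lia.
Qed.

Lemma parent_gt_of_lt s k i : s < clen k i -> parent_gt s k i.
Proof.
case: k => // k; have [a [b [bM ->]]] := int_divP M i M_gt0; rewrite parent_gt_child // => h.
have /andP[_] := clen_child_bounds k a _ bM; have := clen_gt0 k a; lra.
Qed.

(* Two neighbours either are siblings, or inherit their densities from the larger cells that end at
   their common end point. *)
Lemma next_cell s k i : parent_gt s k i -> exists k' i', [/\ node k' i' = node k (i + 1), parent_gt s k' i',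
  dens k i <= K ^+ 2 * dens k' i' & dens k' i' <= K ^+ 2 * dens k i].
Proof.
have K0 := K_gt0.
elim: k i => [|k IH] i.
  by exists 0%N, (i + 1); rewrite !dens0 mulr1 exprn_ege1 ?K_ge1.
have [a [b [bM ->]]] := int_divP M i M_gt0; rewrite parent_gt_child // => sa.
case: (ltnP b.+1 M) => bM1.
  exists k.+1, (a * M%:Z + b.+1%:Z); rewrite parent_gt_child //.
  have /andP[lo1 hi1] := dens_child k a _ bM; have /andP[lo2 hi2] := dens_child k a _ bM1.
  rewrite (ler_pdivrMr _ _ K0) in lo1; rewrite (ler_pdivrMr _ _ K0) in lo2.
  split=> //; first by congr node; lia.
    by apply: (le_trans hi1); rewrite expr2 -mulrA ler_pM2l // mulrC.
  by apply: (le_trans hi2); rewrite expr2 -mulrA ler_pM2l // mulrC.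
have bE : b%:Z = M.-1%:Z by lia.
have [k' [i' [pE ak' d1 d2]]] := IH a (parent_gt_of_lt _ _ _ sa).
exists k', i'; rewrite bE dens_last; split => //.
rewrite pE; have -> : a * M%:Z + M.-1%:Z + 1 = (a + 1) * M%:Z by lia.
by have [-> _] := grid_child k (a + 1).
Qed.

Lemma clen0 i : clen 0 i = T.
Proof. by rewrite /clen /node /= intrD; ring. Qed.

Lemma clen_ge s k i : s < T -> parent_gt s k i -> clen k i <= s -> s / K <= clen k i.
Proof.
case: k => [|k]; first by rewrite clen0 => h _ /(lt_le_trans h); rewrite ltxx.
have [a [b [bM ->]]] := int_divP M i M_gt0; rewrite parent_gt_child // => _ h _.
have /andP[+ _] := clen_child_bounds k a _ bM; apply: le_trans.
by rewrite ler_pM2r ?invr_gt0 ?K_gt0 // ltW.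
Qed.

(** Passing to the first child keeps the left end and the density and at least halves the length, so
    iterating reaches the scale [s]; [n] bounds the number of halvings. *)
Lemma descend s k i : 0 < s -> s < T -> parent_gt s k i -> exists k' i',
  [/\ node k' i' = node k i, parent_gt s k' i', dens k' i' = dens k i & s / K <= clen k' i' <= s].
Proof.
move=> s0 sT.
have [n hn] : exists n, clen k i <= 2 ^+ n * s.
  exists (Num.bound (clen k i / s)); rewrite -ler_pdivrMr //.
  have /ltW h := archi_boundP (divr_ge0 (ltW (clen_gt0 k i)) (ltW s0)).
  by apply: (le_trans h); rewrite -natrX ler_nat; exact/ltnW/ltn_expl.
elim: n k i hn => [|n IH] k i hn adms.
  exists k, i; split => //; rewrite expr0 mul1r in hn.
  by rewrite hn clen_ge.
case: (lerP (clen k i) s) => ls; first by exists k, i; rewrite ls clen_ge.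
have M0 : (0 < M)%N by lia.
have /andP[_ hi] := clen_child_bounds k i _ M0; rewrite addr0 in hi.
have [||k' [i' [pE a' dE lE]]] := IH k.+1 (i * M%:Z).
- by move: hn; rewrite exprS; set A := 2 ^+ n => ?; lra.
- by rewrite -[i * _]addr0 parent_gt_child.
- exists k', i'; split=> //; first by have [<- _] := grid_child k i.
  by rewrite dE dens_first.
Qed.

Lemma clen_le k i : clen k i <= T / 2 ^+ k.
Proof.
elim: k i => [|k IH] i; first by rewrite clen0 expr0 divr1.
have [a [b [bM ->]]] := int_divP M i M_gt0.
have /andP[_ /le_trans] := clen_child_bounds k a _ bM; apply.
by rewrite exprSr invfM mulrA ler_pM2r ?invr_gt0 //; exact: IH.
Qed.

Lemma exists_len_le s : 0 < s -> exists k, forall i, clen k i <= s.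
Proof.
move=> s0; have h2 : 0 < 1 - 2^-1 :> R by lra.
have [k hk] := exists_expr_le R (2^-1) s T ltac:(lra) s0 T0.
exists k => i; apply: (le_trans (clen_le k i)); apply: le_trans hk.
have -> : 1 - 2^-1 = 2^-1 :> R by lra.
by rewrite exprVn mulrC.
Qed.

Lemma parent_contains k a (b : nat) x : (b < M)%N ->
  node k.+1 (a * M%:Z + b%:Z) <= x < node k.+1 (a * M%:Z + b%:Z + 1) ->
  node k a <= x < node k (a + 1).
Proof.
move=> bM /andP[h1 h2]; have [<- _] := grid_child k a; have [<- _] := grid_child k (a + 1).
apply/andP; split; first by apply: le_trans h1; apply: int_seq_le (node_lt _) _ _ _; lia.
by apply: (lt_le_trans h2); apply: int_seq_le (node_lt _) _ _ _; lia.
Qed.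

Lemma first_small_cell s x : 0 < s -> s < T -> exists k i,
  [/\ node k i <= x < node k (i + 1), parent_gt s k i & s / K <= clen k i <= s].
Proof.
move=> s0 sT.
pose P k := `[< exists i, node k i <= x < node k (i + 1) /\ clen k i <= s >].
have exP : exists k, P k.
  have [k hk] := exists_len_le s s0; exists k; apply/asboolP.
  by have [i hi] := locate k x; exists i.
case: (ex_minnP exP) => k /asboolP[i [xi li]] kmin; exists k, i.
(* [k] is the least generation whose cell around [x] is short, so the parent, which also contains
   [x], is longer than [s]. *)
have adms : parent_gt s k i.
  case: k i xi li kmin => // k i xi li kmin.
  move: xi; have [a [b [bM ->]]] := int_divP M i M_gt0; rewrite parent_gt_child // => xi.
  rewrite ltNge; apply/negP => la; have := kmin k; rewrite ltnn => h; apply/notF/h.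
  by apply/asboolP; exists a; split=> //; apply: parent_contains xi.
by split=> //; rewrite li clen_ge.
Qed.

(** Tiles a half line by consecutive cells of length comparable to [s]: [next_cell] gives an
    adjacent cell of comparable density, possibly too long, and [descend] shortens it at no cost in
    density. *)
Lemma march (s x : R) : 0 < s -> s < T -> exists u D : nat -> R, [/\ u 0%N <= x < u 1%N,
  forall n, s / K <= u n.+1 - u n <= s,
  forall n, cumul (u n.+1) - cumul (u n) = D n * (u n.+1 - u n),
  forall n, 0 < D n
  & forall n, D n <= K ^+ 2 * D n.+1 /\ D n.+1 <= K ^+ 2 * D n].
Proof.
move=> s0 sT.
pose P (c : nat * int) := parent_gt s c.1 c.2 /\ s / K <= clen c.1 c.2 <= s.
have step c : exists c', P c -> [/\ P c', node c'.1 c'.2 = node c.1 (c.2 + 1),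
    dens c.1 c.2 <= K ^+ 2 * dens c'.1 c'.2 & dens c'.1 c'.2 <= K ^+ 2 * dens c.1 c.2].
  case: (pselect (P c)) => [[ac lc]|nP]; last by exists c.
  have [k [i [pE ak d1 d2]]] := next_cell s _ _ ac.
  have [k' [i' [pE' ak' dE lE]]] := descend s _ _ s0 sT ak.
  by exists (k', i') => _; rewrite /= pE' pE dE.
have [f fP] := choice step.
have [k [i [xi ak lk]]] := first_small_cell s x s0 sT.
pose c n := iter n f (k, i).
have Pc n : P (c n) by elim: n => [|n IH] //; case: (fP _ IH).
have ptS n : node (c n.+1).1 (c n.+1).2 = node (c n).1 ((c n).2 + 1) by case: (fP _ (Pc n)).
exists (fun n => node (c n).1 (c n).2), (fun n => dens (c n).1 (c n).2); split.
- by rewrite ptS.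
- by move=> n; rewrite ptS; case: (Pc n).
- by move=> n; rewrite ptS !cumul_node nmass_incr.
- by move=> n; exact: dens_gt0.
- by move=> n; case: (fP _ (Pc n)).
Qed.

Lemma cumul_lt x y : x < y -> cumul x < cumul y.
Proof.
move=> xy; pose s := Num.min ((y - x) / 4) (T / 2).
have s0 : 0 < s by rewrite lt_min !divr_gt0 ?subr_gt0.
have s1 : s <= (y - x) / 4 by rewrite ge_min lexx.
have sT : s < T by apply: (@le_lt_trans _ _ (T / 2)); [rewrite ge_min lexx orbT|have := T0; lra].
have [k [i [/andP[h1 h2] _ /andP[_ h3]]]] := first_small_cell s ((x + y) / 2) s0 sT.
rewrite /clen in h3.
have : cumul x <= cumul (node k i) by apply: cumul_le; lra.
have : cumul (node k (i + 1)) <= cumul y by apply: cumul_le; lra.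
by rewrite !cumul_node; have := nmass_lt k i; lra.
Qed.

(** Cells of generation [0] have density [1] and length [T], so [cumul] stays within [T] of the
    identity. This handles large radii. *)
Lemma cumul_dist x : x - T <= cumul x <= x + T.
Proof.
have [i /andP[h1 h2]] := locate 0 x.
have /andP[] : nmass 0 i <= cumul x <= nmass 0 (i + 1) by apply: cumul_cell; rewrite h1 ltW.
have lE := clen0 i; rewrite /clen in lE.
have vE j : nmass 0 j = node 0 j by []; rewrite !vE => h3 h4.
by apply/andP; split; lra.
Qed.

(** With [s = r / 16], fewer than [65 * K] steps of a chain of cells of length at least [s / K]
    cover the large interval, of length [64 * s]. Their densities differ from the initial one by a
    factor of at most [Q], and one of the cells lies in the small interval. *)
Lemma cumul_doubling_small : exists2 C, 0 < C & forall x r : R, 0 < r < 16 * T ->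
  cumul (x + 2 * r) - cumul (x - 2 * r) <= C * (cumul (x + r / 2) - cumul (x - r / 2)).
Proof.
have K0 := K_gt0; have K1 := K_ge1.
have [N NK] : exists N, 65 * K < N%:R.
  by exists (Num.bound (65 * K)); apply: archi_boundP; rewrite mulr_ge0 // ltW.
have [Q QE] : exists Q, Q = (K ^+ 2) ^+ N by exists ((K ^+ 2) ^+ N).
have Q0 : 0 < Q by rewrite QE !exprn_gt0.
have N0 : 0 < N%:R :> R by apply: lt_trans NK; rewrite mulr_gt0.
exists (N%:R * Q * Q * K); first by rewrite !mulr_gt0.
move=> x r /andP[r0 rT].
have [s rs] : exists s, r = 16 * s by exists (r / 16); lra.
have s0 : 0 < s by lra.
have sT : s < T by lra.
have [u [D [/andP[u0 u1] ulen uF D0 Drat]]] := march s (x - 2 * r) s0 sT.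
have sK0 : 0 < s / K by rewrite divr_gt0.
have D_up n : D n <= (K ^+ 2) ^+ n * D 0%N.
  elim: n => [|n IH]; first by rewrite expr0 mul1r.
  have [_ /le_trans] := Drat n; apply; by rewrite (exprS _ n) -mulrA ler_pM2l ?exprn_gt0.
have D_dn n : D 0%N <= (K ^+ 2) ^+ n * D n.
  elim: n => [|n IH]; first by rewrite expr0 mul1r.
  apply: (le_trans IH); rewrite (exprSr _ n) -mulrA ler_pM2l ?exprn_gt0 //.
  by case: (Drat n).
have QN n : (n <= N)%N -> (K ^+ 2) ^+ n <= Q.
  by move=> nN; rewrite QE ler_weXn2l // exprn_ege1.
have u_lo n : u 0%N + n%:R * (s / K) <= u n.
  elim: n => [|n IH]; first by rewrite mul0r addr0.
  have /andP[+ _] := ulen n; rewrite -natr1 mulrDl mul1r; lra.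
have uN : x + 2 * r <= u N.
  apply: le_trans (u_lo N).
  have : 65 * s <= N%:R * (s / K).
    have -> : N%:R * (s / K) = N%:R / K * s by ring.
    by rewrite ler_pM2r // ler_pdivlMr // ltW.
  have /andP[_ ] := ulen 0%N; lra.
have upper n : (n <= N)%N -> cumul (u n) - cumul (u 0%N) <= n%:R * (Q * D 0%N * s).
  elim: n => [|n IH] nN; first by rewrite mul0r subrr.
  have := IH (ltnW nN); have := uF n.
  have : D n * (u n.+1 - u n) <= Q * D 0%N * s.
    have /andP[l1 l2] := ulen n; apply: ler_pM => //; first exact: ltW.
      by apply: le_trans l1; exact: ltW.
    by apply: (le_trans (D_up n)); rewrite ler_pM2r //; exact: QN (ltnW nN).
  by rewrite -natr1 mulrDl mul1r; lra.
have up : cumul (x + 2 * r) - cumul (x - 2 * r) <= N%:R * (Q * D 0%N * s).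
  apply: le_trans (upper N (leqnn _)).
  by apply: lerB; apply: cumul_le.
(* The first node past [x - r / 2] is less than [s] beyond it, so the cell starting there ends
   before [x + r / 2 = x - r / 2 + 16 * s]. *)
have exn : exists n, x - r / 2 <= u n by exists N; lra.
case: (ex_minnP exn) => n un nmin.
have nN : (n <= N)%N by apply: nmin; lra.
have n_gt0 : (0 < n)%N by rewrite lt0n; apply/eqP => n0; rewrite n0 in un; lra.
have un1 : u n < x - r / 2 + s.
  have : u n.-1 < x - r / 2.
    by rewrite ltNge; apply/negP => /nmin; rewrite leqNgt ltn_predL n_gt0.
  by have /andP[_] := ulen n.-1; rewrite (ltn_predK n_gt0); lra.
have low : D n * (s / K) <= cumul (x + r / 2) - cumul (x - r / 2).
  apply: (@le_trans _ _ (cumul (u n.+1) - cumul (u n))).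
    by rewrite uF ler_pM2l //; case/andP: (ulen n).
  by apply: lerB; apply: cumul_le => //; case/andP: (ulen n); lra.
apply: (le_trans up).
have C0 : 0 <= N%:R * Q * Q * K by rewrite !mulr_ge0 // ltW.
apply: le_trans (ler_wpM2l C0 low).
have -> : N%:R * Q * Q * K * (D n * (s / K)) = N%:R * (Q * (Q * D n) * s).
  by field; rewrite gt_eqF.
rewrite ler_pM2l // ler_pM2r // ler_pM2l //.
by apply: (le_trans (D_dn n)); rewrite ler_pM2r //; exact: QN.
Qed.

Lemma cumul_doubling : exists2 C, 0 < C & forall x r : R, 0 < r ->
  cumul (x + 2 * r) - cumul (x - 2 * r) <= C * (cumul (x + r / 2) - cumul (x - r / 2)).
Proof.
have [C C0 CP] := cumul_doubling_small.
(* For [16 * T <= r], [cumul_dist] bounds the left side by [4 * r + 2 * T] and the small increment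
   from below by [r - 2 * T]; the factor [10] suffices. *)
exists (C + 10); first by rewrite addr_gt0.
move=> x r r0.
have lt : 0 < cumul (x + r / 2) - cumul (x - r / 2).
  by rewrite subr_gt0; apply: cumul_lt; lra.
rewrite (mulrDl C).
have h1 := mulr_gt0 C0 lt.
case: (ltrP r (16 * T)) => rT.
  have h2 := CP x r; rewrite r0 rT in h2.
  have := h2 isT; lra.
have T0' := T0.
have := cumul_dist (x + 2 * r); have := cumul_dist (x - 2 * r).
have := cumul_dist (x + r / 2); have := cumul_dist (x - r / 2); lra.
Qed.

(** * Mass near a point of concentration *)

(** Descending through the cells containing [z], the length ratios telescope, until a cell has
    length at most [h] and so lies in the interval of radius [h] around [z]. The factor [K] absorbs
    the overshoot of the last step. *)
Lemma mass_concentration (z l h p : R) : 0 < p -> 0 < l < T -> 0 < h <= l ->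
  (forall k a, node k a <> z) ->
  (forall k a, node k a < z < node k (a + 1) -> clen k a <= l -> exists b : nat,
    [/\ (b < M)%N, node k.+1 (a * M%:Z + b%:Z) < z < node k.+1 (a * M%:Z + b%:Z + 1) &
      (clen k.+1 (a * M%:Z + b%:Z) / clen k a) `^ p * (nmass k (a + 1) - nmass k a) <=
      nmass k.+1 (a * M%:Z + b%:Z + 1) - nmass k.+1 (a * M%:Z + b%:Z)]) ->
  exists k a, [/\ node k a < z < node k (a + 1), l / K <= clen k a <= l &
    (h / (K * l)) `^ p * (nmass k (a + 1) - nmass k a) <= cumul (z + h) - cumul (z - h)].
Proof.
move=> p0 /andP[l0 lT] /andP[h0 hl] ptz sub; have K0 := K_gt0.
have main n k a : node k a < z < node k (a + 1) -> clen k a <= l -> h / K <= clen k a ->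
    clen k a <= 2 ^+ n * h ->
    (h / (K * clen k a)) `^ p * (nmass k (a + 1) - nmass k a) <= cumul (z + h) - cumul (z - h).
  have stop k' a' : node k' a' < z < node k' (a' + 1) -> h / K <= clen k' a' -> clen k' a' <= h ->
      (h / (K * clen k' a')) `^ p * (nmass k' (a' + 1) - nmass k' a')
      <= cumul (z + h) - cumul (z - h).
    move=> /andP[z1 z2] lo hi; have lp := clen_gt0 k' a'.
    have v0 : 0 <= nmass k' (a' + 1) - nmass k' a' by rewrite subr_ge0 ltW // nmass_lt.
    apply: (@le_trans _ _ (nmass k' (a' + 1) - nmass k' a')).
      rewrite -[leRHS]mul1r; apply: ler_wpM2r => //.
      have q0 : 0 <= h / (K * clen k' a') by rewrite divr_ge0 ?mulr_ge0 // ltW.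
      have q1 : h / (K * clen k' a') <= 1.
        by rewrite ler_pdivrMr ?mulr_gt0 // mul1r -ler_pdivrMl // mulrC.
      rewrite (_ : 1 = 1 `^ p); last by rewrite powR1.
      apply: ge0_ler_powR; rewrite ?nnegrE //; exact: ltW.
    rewrite -!cumul_node; rewrite /clen in hi; apply: lerB; apply: cumul_le; lra.
  elim: n k a => [|n IH] k a zin ll lh hn.
    by apply: stop => //; rewrite -[h]mul1r -(expr0 2).
  case: (lerP (clen k a) h) => lenh; first exact: stop.
  have [b [bM zin' mass]] := sub k a zin ll.
  have /andP[lo hi] := clen_child_bounds k a _ bM.
  have lp := clen_gt0 k a.
  have lp' := clen_gt0 k.+1 (a * M%:Z + b%:Z).
  have := IH k.+1 (a * M%:Z + b%:Z) zin'; rewrite -!/(clen _ _).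
  have l1 : clen k.+1 (a * M%:Z + b%:Z) <= l by lra.
  have l2 : h / K <= clen k.+1 (a * M%:Z + b%:Z).
    by apply: le_trans lo; rewrite ler_pM2r ?invr_gt0 // ltW.
  have l3 : clen k.+1 (a * M%:Z + b%:Z) <= 2 ^+ n * h.
    by move: hn; rewrite exprS; set A := 2 ^+ n => ?; lra.
  move=> /(_ l1 l2 l3); apply: le_trans.
  have q0 : 0 <= h / (K * clen k.+1 (a * M%:Z + b%:Z)).
    by rewrite divr_ge0 ?mulr_ge0 // ltW.
  apply: le_trans (ler_wpM2l (powR_ge0 _ p) mass); rewrite mulrA -powRM //; last first.
    by rewrite divr_ge0 // ltW.
  set x := clen k.+1 _ in lp' *; rewrite le_eqVlt; apply/orP; left; apply/eqP.
  by congr (_ `^ p * _); field; rewrite !gt_eqF.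
have [k [a [/andP[z1 z2] _ /andP[lo hi]]]] := first_small_cell l z l0 lT.
have zin : node k a < z < node k (a + 1).
  by rewrite z2 andbT lt_neqAle z1 andbT; apply/eqP; exact: ptz.
have [n hn] : exists n, clen k a <= 2 ^+ n * h.
  exists (Num.bound (clen k a / h)); rewrite -ler_pdivrMr //.
  have /ltW hb := archi_boundP (divr_ge0 (ltW (clen_gt0 k a)) (ltW h0)).
  by apply: (le_trans hb); rewrite -natrX ler_nat; exact/ltnW/ltn_expl.
have hlo : h / K <= clen k a by apply: le_trans lo; rewrite ler_pM2r ?invr_gt0.
exists k, a; rewrite lo hi; split => //; apply: le_trans (main n k a zin hi hlo hn).
have lp := clen_gt0 k a.
apply: ler_wpM2r; first by rewrite subr_ge0 ltW // nmass_lt.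
apply: ge0_ler_powR; rewrite ?nnegrE ?divr_ge0 ?mulr_ge0 ?(ltW p0) ?(ltW K0) ?(ltW h0) ?(ltW lp) ?(ltW l0) //.
by rewrite ler_pM2l // lef_pV2 ?posrE ?mulr_gt0 // ler_pM2l.
Qed.

Lemma cumul_doubling_iter (A : R) : 0 < A -> exists2 C, 0 < C & forall x r : R, 0 < r ->
  cumul (x + A * r) - cumul (x - A * r) <= C * (cumul (x + r) - cumul (x - r)).
Proof.
move=> A0; have [C C0 CP] := cumul_doubling.
have iterC n : forall x r : R, 0 < r ->
    cumul (x + 4 ^+ n * r) - cumul (x - 4 ^+ n * r) <= C ^+ n * (cumul (x + r) - cumul (x - r)).
  elim: n => [|n IH] x r r0; first by rewrite !expr0 !mul1r.
  rewrite (exprS C) -(mulrA C); apply: (le_trans _ (ler_wpM2l (ltW C0) (IH x r r0))).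
  have q0 : 0 < 4 ^+ n * r by rewrite mulr_gt0 // exprn_gt0.
  have := CP x (2 * (4 ^+ n * r)) ltac:(lra).
  have -> : 2 * (2 * (4 ^+ n * r)) = 4 ^+ n.+1 * r by rewrite exprS; ring.
  by have -> : 2 * (4 ^+ n * r) / 2 = 4 ^+ n * r by lra.
exists (C ^+ Num.bound A); first exact: exprn_gt0.
move=> x r r0; apply: le_trans (iterC (Num.bound A) x r r0).
have h : A <= 4 ^+ Num.bound A.
  have /ltW hb := archi_boundP (ltW A0).
  by apply: (le_trans hb); rewrite -natrX ler_nat; exact/ltnW/ltn_expl.
have hr : A * r <= 4 ^+ Num.bound A * r by rewrite ler_pM2r.
by apply: lerB; apply: cumul_le; lra.
Qed.

End Tree.

(** * Concentrating mass around given points *)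

Ltac nat_lia :=
  repeat match goal with
  | H : is_true (_ <= _)%N |- _ => revert H
  | H : is_true (_ && _) |- _ => revert H
  | H : @eq nat _ _ |- _ => revert H
  end; clear; lia.

Section Concentration.
Context {R : realType} {E : R -> R -> Prop} {delta B p : R} {M : nat}.
Hypotheses (delta0 : 0 < delta) (delta1 : delta <= 1) (p0 : 0 < p).
Hypothesis Epos : forall z l, E z l -> 0 < l.
Hypothesis Esep : forall z l z' l', E z l -> E z' l' -> z <> z' ->
  2 * delta * Num.min l l' <= `|z - z'|.
Hypothesis Ebnd : forall z l, E z l -> `|z| <= B /\ l <= B.
Hypotheses (B0 : 0 < B) (M10 : (10 <= M)%N) (Mdelta : 2 / M%:R < delta / 512)
  (Mp : (2 / M%:R) `^ p <= 1 - 5 / M%:R).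

(** For positive [eta] a good point exists, so the default [t] is not taken. *)
Definition good_near (t eta : R) : R :=
  xget t [set u | `|u - t| <= eta /\
    forall z l, E z l -> delta / 32 * Num.min l eta <= `|u - z|]%classic.

(** Equally spaced points, the inner ones moved by at most an eighth of the spacing to keep away
    from the points of [E]. *)
Definition breakpoint (u v : R) (b : nat) : R :=
  if b == 0%N then u else if b == M then v
  else good_near (u + (v - u) / M%:R * b%:R) ((v - u) / (8 * M%:R)).

(** The size condition [v - u <= delta * l] makes the target unique by separation; outer children
    are excluded because they must keep their density. *)
Definition target (u v : R) (b : nat) : Prop :=
  [/\ (0 < b)%N, (b.+1 < M)%N & exists z l, [/\ E z l, v - u <= delta * l
    & breakpoint u v b < z < breakpoint u v b.+1]].

(* When some child is a target, the other inner children [1 .. M-2] receive density [1 / M] and the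
   target the remaining mass; in all cases the two outer children keep density [1]. *)
Definition massfun (u v : R) (b : nat) : R :=
  let S := breakpoint u v in
  if b == 0%N then u else if b == M then v
  else if pselect (exists c, target u v c) is left h then
    M%:R^-1 * S b + (1 - M%:R^-1) * (if (b <= projT1 (cid h))%N then S 1%N else S M.-1)
  else S b.

Lemma good_nearP t eta : 0 < eta -> `|good_near t eta - t| <= eta /\
  forall z l, E z l -> delta / 32 * Num.min l eta <= `|good_near t eta - z|.
Proof.
move=> eta0; rewrite /good_near; case: xgetP => [u -> //|no].
have [u hu] := exists_good_point _ _ _ delta0 delta1 Epos Esep t eta eta0.
by case: (no u).
Qed.

Let MR : 10 <= M%:R :> R. Proof. by rewrite (ler_nat R 10). Qed.
Let MR0 : 0 < M%:R :> R. Proof. by apply: lt_le_trans MR. Qed.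

Let M_gt0 : (0 < M)%N. Proof. exact: leq_trans M10. Qed.
Let iM : 0 < M%:R^-1 :> R /\ M%:R^-1 <= 1 / 10 :> R.
Proof. by rewrite invr_gt0 MR0 mul1r lef_pV2 ?posrE. Qed.

Let delta512 : 0 < delta / 512.
Proof. have h : 0 < 512 :> R by rewrite ltr0n. exact: (divr_gt0 delta0 h). Qed.

Lemma breakpoint0 u v : breakpoint u v 0 = u. Proof. by []. Qed.

Lemma breakpointM u v : breakpoint u v M = v.
Proof. by rewrite /breakpoint eqxx; case: eqP => // M0; have := M10; rewrite M0. Qed.

Lemma breakpoint_good u v b : u < v -> (0 < b < M)%N ->
  `|breakpoint u v b - (u + (v - u) / M%:R * b%:R)| <= (v - u) / (8 * M%:R) /\
  forall z l, E z l -> delta / 32 * Num.min l ((v - u) / (8 * M%:R)) <= `|breakpoint u v b - z|.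
Proof.
move=> uv /andP[b0 bM]; rewrite /breakpoint (gtn_eqF b0) (ltn_eqF bM).
by apply: good_nearP; rewrite divr_gt0 ?subr_gt0 ?mulr_gt0.
Qed.

Lemma breakpoint_near u v b : u < v -> (b <= M)%N ->
  `|breakpoint u v b - (u + (v - u) / M%:R * b%:R)| <= (v - u) / (8 * M%:R).
Proof.
move=> uv bM; have e0 : 0 <= (v - u) / (8 * M%:R).
  by rewrite ltW // divr_gt0 ?subr_gt0 ?mulr_gt0.
case: (posnP b) => [->|b0]; first by rewrite breakpoint0 mulr0 addr0 subrr normr0.
case: (ltnP b M) => bM'; first by have [] := breakpoint_good u v b uv; rewrite ?b0.
have -> : b = M by nat_lia.
by rewrite breakpointM divfK ?gt_eqF // addrCA subrr addr0 subrr normr0.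
Qed.

Lemma breakpoint_len u v b : u < v -> (b < M)%N ->
  (v - u) / (2 * M%:R) <= breakpoint u v b.+1 - breakpoint u v b <= 2 * (v - u) / M%:R.
Proof.
move=> uv bM; have := breakpoint_near u v b uv (ltnW bM).
have := breakpoint_near u v b.+1 uv bM; rewrite !ler_distl -natr1.
set x := breakpoint _ _ _; set y := breakpoint _ _ _.
rewrite !invfM; set m := (v - u) * M%:R^-1.
have m0 : 0 < m by rewrite divr_gt0 // subr_gt0.
have -> : (v - u) * (8^-1 * M%:R^-1) = m / 8 by rewrite /m; ring.
have -> : (v - u) * (2^-1 * M%:R^-1) = m / 2 by rewrite /m; ring.
have -> : 2 * (v - u) / M%:R = 2 * m by rewrite /m; ring.
rewrite mulrDr mulr1; set w := m * b%:R => h1 h2; apply/andP; split; lra.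
Qed.

Lemma breakpoint_lt u v b c : u < v -> (b < c <= M)%N -> breakpoint u v b < breakpoint u v c.
Proof.
move=> uv /andP[bc]; have -> : c = (b + (c - b.+1)).+1 by nat_lia.
have step n : (n < M)%N -> breakpoint u v n < breakpoint u v n.+1.
  move=> nM; rewrite -subr_gt0; have /andP[+ _] := breakpoint_len u v n uv nM.
  by apply: lt_le_trans; rewrite divr_gt0 ?subr_gt0 ?mulr_gt0.
elim: (c - b.+1)%N => [|n IH] hn; first by rewrite addn0 in hn *; apply: step.
by rewrite addnS in hn *; apply: lt_trans (IH _) (step _ _); nat_lia.
Qed.

Lemma breakpoint_le u v b c : u < v -> (b <= c <= M)%N -> breakpoint u v b <= breakpoint u v c.
Proof.
move=> uv /andP[]; rewrite leq_eqVlt => /orP[/eqP->//|bc cM].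
by apply/ltW/breakpoint_lt; rewrite ?bc.
Qed.

Lemma massfunE u v b : (0 < b < M)%N -> (forall c, ~ target u v c) ->
  massfun u v b = breakpoint u v b.
Proof.
move=> /andP[b0 bM] no; rewrite /massfun (gtn_eqF b0) (ltn_eqF bM).
by case: pselect => // h; exfalso; case: h => c /no.
Qed.

Lemma massfun_targetE u v c b : (0 < b < M)%N -> (forall c', target u v c' <-> c' = c) ->
  massfun u v b = M%:R^-1 * breakpoint u v b +
    (1 - M%:R^-1) * (if (b <= c)%N then breakpoint u v 1%N else breakpoint u v M.-1).
Proof.
move=> /andP[b0 bM] uniq; rewrite /massfun (gtn_eqF b0) (ltn_eqF bM).
have ex : exists c, target u v c by exists c; exact: (uniq c).2.
case: pselect => // h.
by case: cid => c' tc'; rewrite /= ((uniq _).1 tc').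
Qed.

(** Two distinct points would be at least [2 * (v - u)] apart although both lie in the cell; so the
    point is the same, and it lies in a single child. *)
Lemma target_uniq u v c c' : u < v -> target u v c -> target u v c' -> c = c'.
Proof.
move=> uv [c0 cM [z [l [Ez ql /andP[z1 z2]]]]] [c'0 c'M [z' [l' [Ez' ql' /andP[z'1 z'2]]]]].
have zz : z = z'.
  apply: contrapT => /(Esep _ _ _ _ Ez Ez').
  have : v - u <= delta * Num.min l l' by rewrite (minr_pMr _ _ (ltW delta0)) le_min ql ql'.
  rewrite -mulrA; set t := delta * _ => t1 t2.
  have inQ n : (n.+1 < M)%N -> u <= breakpoint u v n /\ breakpoint u v n.+1 <= v.
    move=> nM; have h1' : (0 <= n <= M)%N by nat_lia.
    have h2' : (n.+1 <= M <= M)%N by nat_lia.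
    by have := breakpoint_le u v _ _ uv h1'; have := breakpoint_le u v _ _ uv h2'; rewrite breakpointM.
  have [a1 a2] := inQ _ cM; have [a3 a4] := inQ _ c'M.
  have : `|z - z'| < v - u by rewrite ltr_distl; apply/andP; split; lra.
  have : 0 < v - u by rewrite subr_gt0.
  by lra.
subst z'; apply/eqP; rewrite eqn_leq; apply/andP; split; rewrite leqNgt; apply/negP => lt.
  by have := breakpoint_le u v c'.+1 c uv; rewrite lt (ltnW (ltnW cM)) => /(_ isT); lra.
by have := breakpoint_le u v c.+1 c' uv; rewrite lt (ltnW (ltnW c'M)) => /(_ isT); lra.
Qed.

Lemma target_or u v : u < v -> (forall c, ~ target u v c) \/
  exists c, [/\ (0 < c)%N, (c.+1 < M)%N & forall c', target u v c' <-> c' = c].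
Proof.
move=> uv; case: (pselect (exists c, target u v c)) => [[c tc]|no]; last first.
  by left=> c tc; apply: no; exists c.
right; exists c; case: (tc) => c0 cM _; split => // c'; split=> [tc'|->//].
exact: target_uniq tc' tc.
Qed.

Lemma massfun0 u v : massfun u v 0 = u. Proof. by []. Qed.

Lemma massfunM u v : massfun u v M = v.
Proof. by rewrite /massfun eqxx; case: eqP => // M0; have := M10; rewrite M0. Qed.

Lemma massfun_first u v : u < v -> massfun u v 1 = breakpoint u v 1.
Proof.
move=> uv; have M1 : (0 < 1 < M)%N by have hM := M10; nat_lia.
case: (target_or u v uv) => [no|[c [c0 cM uniq]]]; first exact: massfunE.
by rewrite (massfun_targetE _ _ c) // c0; ring.
Qed.

Lemma massfun_last u v : u < v -> massfun u v M.-1 = breakpoint u v M.-1.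
Proof.
move=> uv; have M1 : (0 < M.-1 < M)%N by have hM := M10; nat_lia.
case: (target_or u v uv) => [no|[c [c0 cM uniq]]]; first exact: massfunE.
by rewrite (massfun_targetE _ _ c) // ifF; [ring | nat_lia].
Qed.

(** Relative densities are [1] or [1 / M], except in the target, which has at most the mass of its
    parent on at least [1 / (2 * M)] of its length. *)
Lemma massfun_incr u v b : u < v -> (b < M)%N ->
  (breakpoint u v b.+1 - breakpoint u v b) / (2 * M%:R) <= massfun u v b.+1 - massfun u v b <=
  2 * M%:R * (breakpoint u v b.+1 - breakpoint u v b).
Proof.
move=> uv bM; set D := breakpoint u v b.+1 - _.
have D0 : 0 < D by rewrite subr_gt0 breakpoint_lt ?leqnn.
have [iM0 iM1] := iM.
have D1 : D / (2 * M%:R) <= D * M%:R^-1.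
  by rewrite invfM mulrCA; have := mulr_gt0 D0 iM0; lra.
have hM := MR; have D2 : D * M%:R^-1 <= D by apply: ler_piMr; lra.
have D3 : D <= 2 * M%:R * D by apply: ler_peMl; lra.
have same : massfun u v b.+1 - massfun u v b = D ->
    D / (2 * M%:R) <= massfun u v b.+1 - massfun u v b <= 2 * M%:R * D.
  by move=> ->; apply/andP; split; lra.
case: (posnP b) => [b0|b0].
  by apply: same; rewrite b0 massfun0 massfun_first // /D b0 breakpoint0.
case: (ltnP b.+1 M) => bM1; last first.
  have bE : b = M.-1 by nat_lia.
  have bE' : M.-1.+1 = M by nat_lia.
  by apply: same; rewrite /D bE massfun_last // bE' massfunM breakpointM.
case: (target_or u v uv) => [no|[c [c0 cM uniq]]].
  by apply: same; rewrite !massfunE ?b0 //; nat_lia.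
rewrite !(massfun_targetE _ _ c) ?b0 //; try nat_lia.
have DE : M%:R^-1 * breakpoint u v b.+1 - M%:R^-1 * breakpoint u v b = M%:R^-1 * D by rewrite -mulrBr.
case: (ltngtP b c) => bc.
- by apply/andP; split; lra.
- by apply/andP; split; lra.
have : breakpoint u v 1 < breakpoint u v M.-1 by apply: breakpoint_lt => //; nat_lia.
have : breakpoint u v 0 < breakpoint u v 1 by apply: breakpoint_lt => //; nat_lia.
have : breakpoint u v M.-1 < breakpoint u v M by apply: breakpoint_lt => //; nat_lia.
rewrite breakpointM breakpoint0.
have /andP[+ _] := breakpoint_len u v b uv bM.
rewrite ler_pdivrMr ?mulr_gt0 // -/D => vu.
set s1 := breakpoint u v 1; set sm := breakpoint u v M.-1 => h1 h2 h3.
have gap : 0 <= (1 - M%:R^-1) * (sm - s1) <= (1 - M%:R^-1) * (2 * M%:R * D).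
  by apply/andP; split; [apply: mulr_ge0 | apply: ler_wpM2l]; lra.
have h4 : M%:R^-1 * D <= M%:R^-1 * (2 * M%:R * D).
  by apply: ler_wpM2l; lra.
by apply/andP; split; lra.
Qed.

(** The outer children have length at most [2 * (v - u) / M] each, and the target gets [1 - 1 / M]
    of what lies between them; moreover [(1 - 1 / M) * (1 - 4 / M) >= 1 - 5 / M]. *)
Lemma massfun_target u v c : u < v -> target u v c ->
  (1 - 5 / M%:R) * (v - u) <= massfun u v c.+1 - massfun u v c.
Proof.
move=> uv tc; have uniq c' : target u v c' <-> c' = c.
  by split=> [/target_uniq|->//]; apply.
have [c0 cM _] := tc.
rewrite !(massfun_targetE _ _ c) ?c0 ?leqnn ?ltnn //; try nat_lia.
have [iM0 iM1] := iM.
have lt : M%:R^-1 * breakpoint u v c <= M%:R^-1 * breakpoint u v c.+1.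
  by apply: ler_wpM2l; [lra | apply: breakpoint_le => //; nat_lia].
have M0 : (0 < M)%N by nat_lia.
have M1 : (M.-1 < M)%N by nat_lia.
have := breakpoint_len u v 0 uv M0; have := breakpoint_len u v M.-1 uv M1.
rewrite (ltn_predK M0) breakpointM breakpoint0.
set s1 := breakpoint u v 1; set sm := breakpoint u v M.-1 => /andP[_ h1] /andP[_ h2].
set i := M%:R^-1 in iM0 iM1 lt h1 h2 *.
have h : (1 - i) * ((1 - 4 * i) * (v - u)) <= (1 - i) * (sm - s1).
  by apply: ler_wpM2l; lra.
have : 0 <= 4 * i * i * (v - u) by rewrite !mulr_ge0 ?subr_ge0 ?(ltW uv) //; lra.
by lra.
Qed.

Lemma concentration_rule : split_rule R M (2 * M%:R) breakpoint massfun.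
Proof.
split.
- by have hM := M10; nat_lia.
- by have := MR; lra.
- exact: breakpoint0.
- exact: breakpointM.
- exact: massfun0.
- exact: massfunM.
- move=> u v b uv bM; have /andP[-> h] := breakpoint_len u v b uv bM.
  apply: (le_trans h); rewrite ler_pdivrMr //.
  have := ler_wpM2l (ltW _ : 0 <= v - u) MR; rewrite subr_gt0 => /(_ uv).
  have : 0 < v - u by rewrite subr_gt0.
  lra.
- exact: massfun_incr.
- exact: massfun_first.
- exact: massfun_last.
Qed.

(** * The tree of cells grown from the concentration rule *)

Let T := 4 * B.
Let T0 : 0 < T. Proof. by rewrite mulr_gt0. Qed.
Local Notation pt := (@node R M T (T / 2) breakpoint massfun).
Local Notation mass := (@nmass R M T (T / 2) breakpoint massfun).
Local Notation len := (@clen R M T (T / 2) breakpoint massfun).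
Local Notation cumul := (@cumul R M T (T / 2) breakpoint massfun).

Let rule := concentration_rule.

(** Ends inherited from the parent stay good because lengths decrease. New ones are good by choice
    with [eta = len / (8 * M)], and a child is no longer than [16 * eta], whence [512 = 32 * 16]. *)
Lemma node_good k a z l : E z l ->
  delta / 512 * Num.min l (len k a) <= `|pt k a - z| /\
  delta / 512 * Num.min l (len k a) <= `|pt k (a + 1) - z|.
Proof.
move=> Ezl; have l0 := Epos _ _ Ezl.
have d0 := delta512.
elim: k a => [|k IH] a.
  (* The nodes of generation [0] are [2 * B + 4 * B * i], of modulus at least [2 * B], whereas [z]
     has modulus at most [B]. *)
  have far i : B <= `|pt 0 i - z|.
    have [+ _] := Ebnd _ _ Ezl; rewrite ler_norml => zB.
    rewrite /node /= ler_normr /T; apply/orP.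
    case: (lerP 0 i) => i0.
      by left; have : 0 <= i%:~R * B; [rewrite mulr_ge0 ?ler0z // ltW | lra].
    right; have i1 : i%:~R <= -1 :> R by rewrite -(mulrN1z (1 : R)) ler_int -ltzD1 addNr.
    by have := ler_wpM2r (ltW B0) i1; rewrite mulN1r; lra.
  have h : delta / 512 * Num.min l (len 0 a) <= B.
    have [_ lB] := Ebnd _ _ Ezl; apply: le_trans lB; apply: (@le_trans _ _ (Num.min l (len 0 a))).
      apply: ler_piMl; first by rewrite le_min (ltW l0) ltW // (clen_gt0 (t0 := T / 2) rule T0).
      by have := delta1; lra.
    by rewrite ge_min lexx.
  by split; apply: le_trans h (far _).
have [a0 [b [bM ->]]] := int_divP M a M_gt0.
have [h1 h2] := IH a0; have uv := node_lt (t0 := T / 2) rule T0 k a0 : pt k a0 < pt k (a0 + 1).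
set l' := len k.+1 _.
have l'E : l' = breakpoint (pt k a0) (pt k (a0 + 1)) b.+1 - breakpoint (pt k a0) (pt k (a0 + 1)) b.
  exact: (clen_child (t0 := T / 2) rule T0 k a0 b bM).
have /andP[_ l'16] := breakpoint_len _ _ b uv bM; rewrite -l'E -/(len k a0) in l'16.
have l'len : l' <= len k a0.
  have /andP[_] := clen_child_bounds (t0 := T / 2) rule T0 k a0 b bM.
  by rewrite -/l'; have := clen_gt0 (t0 := T / 2) rule T0 k a0; lra.
have mono : delta / 512 * Num.min l l' <= delta / 512 * Num.min l (len k a0).
  by apply: ler_wpM2l; [exact: ltW | exact: le_min2].
have all c : (c <= M)%N ->
    delta / 512 * Num.min l l' <= `|breakpoint (pt k a0) (pt k (a0 + 1)) c - z|.
  rewrite leq_eqVlt => /orP[/eqP->|cM].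
    by rewrite breakpointM; apply: le_trans mono h2.
  case: (posnP c) => [->|c0]; first by rewrite breakpoint0; apply: le_trans mono h1.
  have [|_ /(_ _ _ Ezl)] := breakpoint_good _ _ c uv; first by rewrite c0.
  apply: le_trans.
  have -> : delta / 512 * Num.min l l' = delta / 32 * (16^-1 * Num.min l l') by field.
  apply: ler_wpM2l; first by rewrite divr_ge0 // ltW.
  rewrite le_min -/(len k a0); apply/andP; split.
    have : Num.min l l' <= l by rewrite ge_min lexx.
    by lra.
  have : Num.min l l' <= l' by rewrite ge_min lexx orbT.
  have -> : len k a0 / (8 * M%:R) = 16^-1 * (2 * len k a0 / M%:R) by field; rewrite gt_eqF.
  by lra.
have [e1 _] := grid_le (t0 := T / 2) rule T0 k a0 b (ltnW bM);
have [e2 _] := grid_le (t0 := T / 2) rule T0 k a0 b.+1 bM.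
rewrite -addrA; have -> : b%:Z + 1 = b.+1%:Z by rewrite -addn1 PoszD.
by split; [rewrite e1 | rewrite e2]; apply: all => //; exact: ltnW.
Qed.

Lemma node_neq z l : E z l -> forall k a, pt k a <> z.
Proof.
move=> Ezl k a e; have [+ _] := node_good k a _ _ Ezl; rewrite e subrr normr0 leNgt => /negP; apply.
by rewrite (pmulr_rgt0 _ delta512) lt_min (Epos _ _ Ezl) (clen_gt0 (t0 := T / 2) rule T0).
Qed.

(** The ends of the cell are at least [delta / 512] of its length away from [z], more than the
    length of an outer child. So [z] lies in an inner child, a target, whose share [1 - 5 / M] of
    the mass exceeds [(2 / M) ^ p]. *)
Lemma concentration_child z l k a : E z l -> pt k a < z < pt k (a + 1) -> len k a <= delta * l ->
  exists b : nat,
    [/\ (b < M)%N, pt k.+1 (a * M%:Z + b%:Z) < z < pt k.+1 (a * M%:Z + b%:Z + 1) &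
      (len k.+1 (a * M%:Z + b%:Z) / len k a) `^ p * (mass k (a + 1) - mass k a) <=
      mass k.+1 (a * M%:Z + b%:Z + 1) - mass k.+1 (a * M%:Z + b%:Z)].
Proof.
move=> Ezl /andP[z1 z2] ql; have l0 := Epos _ _ Ezl.
have uv := node_lt (t0 := T / 2) rule T0 k a : pt k a < pt k (a + 1).
have q0 := clen_gt0 (t0 := T / 2) rule T0 k a : 0 < len k a.
have [b [bM zin]] : exists b : nat, (b < M)%N /\
    pt k.+1 (a * M%:Z + b%:Z) <= z < pt k.+1 (a * M%:Z + b%:Z + 1).
  by apply: (locate_child (t0 := T / 2) rule T0); rewrite (ltW z1).
have zb : pt k.+1 (a * M%:Z + b%:Z) < z < pt k.+1 (a * M%:Z + b%:Z + 1).
  case/andP: zin => zin1 ->; rewrite andbT lt_neqAle zin1 andbT.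
  by apply/eqP; exact: (node_neq z l Ezl).
exists b; split=> //.
have [e1 _] := grid_le (t0 := T / 2) rule T0 k a b (ltnW bM);
have [e2 _] := grid_le (t0 := T / 2) rule T0 k a b.+1 bM.
have zb' : breakpoint (pt k a) (pt k (a + 1)) b < z < breakpoint (pt k a) (pt k (a + 1)) b.+1.
  by rewrite -e1 -e2; move: zb; rewrite -addrA; have -> : b%:Z + 1 = b.+1%:Z by rewrite -addn1 PoszD.
have lmin : Num.min l (len k a) = len k a.
  by apply: min_r; apply: (le_trans ql); rewrite ler_piMl // ltW.
have [g1 g2] := node_good k a _ _ Ezl; rewrite lmin in g1 g2.
have small : 2 * len k a / M%:R < delta / 512 * len k a.
  by have := Mdelta; rewrite -(ltr_pM2r q0); lra.
rewrite ltr0_norm ?subr_lt0 // in g1; rewrite gtr0_norm ?subr_gt0 // in g2.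
have tb : target (pt k a) (pt k (a + 1)) b.
  split; last by exists z, l.
    rewrite lt0n; apply/eqP => b0; have /andP[_] := breakpoint_len _ _ _ uv bM.
    by rewrite b0 breakpoint0 in zb' *; rewrite -/(len k a); lra.
  rewrite ltn_neqAle bM andbT; apply/eqP => bM'.
  have /andP[_] := breakpoint_len _ _ _ uv bM.
  by rewrite bM' breakpointM in zb' *; rewrite -/(len k a); lra.
have m := massfun_target _ _ _ uv tb.
rewrite (nmass_child (t0 := T / 2) rule T0 k a b bM) (nmass_incr (t0 := T / 2) rule T0) mulrCA.
apply: ler_wpM2l; first exact: ltW (dens_gt0 (t0 := T / 2) rule T0 k a).
apply: le_trans m; rewrite -/(len k a); apply: ler_wpM2r; first exact: ltW.
apply: le_trans Mp; have l'0 := clen_gt0 (t0 := T / 2) rule T0 k.+1 (a * M%:Z + b%:Z).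
have r2 : len k.+1 (a * M%:Z + b%:Z) / len k a <= 2 / M%:R.
  rewrite ler_pdivrMr // (clen_child (t0 := T / 2) rule T0) //.
  by have /andP[_] := breakpoint_len _ _ b uv bM; rewrite -/(len k a); lra.
apply: ge0_ler_powR => //; first exact: ltW.
  by rewrite nnegrE divr_ge0 // ltW.
by rewrite nnegrE divr_ge0 // ltW.
Qed.

(** Concentration is run from scale [delta * l], below which [z] determines a target, down to
    [delta * h]; doubling then compares the starting cell with the interval of radius [2 * l]. *)
Lemma cumul_concentrated : exists2 c, 0 < c & forall z l h : R, E z l -> 0 < h <= l ->
  c * (h / l) `^ p * (cumul (z + 2 * l) - cumul (z - 2 * l)) <= cumul (z + h) - cumul (z - h).
Proof.
pose K : R := 2 * M%:R; have K0 : 0 < K by rewrite mulr_gt0.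
(* The starting cell has length at least [delta * l / K], so scaling its half-length by
   [6 * K / delta] gives at least [3 * l]: [2 * l] to cover, and [l] for the offset of [z] from the
   midpoint. *)
have A0 : 0 < 6 * K / delta by rewrite divr_gt0 ?mulr_gt0.
have [C C0 CP] := cumul_doubling_iter (t0 := T / 2) rule T0 _ A0.
have D0 : 0 < (K^-1) `^ p by rewrite powR_gt0 // invr_gt0.
exists ((K^-1) `^ p / C); first by rewrite divr_gt0.
move=> z l h Ezl /andP[h0 hl]; have l0 := Epos _ _ Ezl; have [_ lB] := Ebnd _ _ Ezl.
have dl0 : 0 < delta * l by rewrite mulr_gt0.
have dlT : delta * l < T.
  apply: (@le_lt_trans _ _ l); first by rewrite ler_piMl // ltW.
  by rewrite /T; have := B0; lra.
have [||k [a [/andP[z1 z2] /andP[lo hi] hmass]]] := mass_concentration (t0 := T / 2) rule T0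
    z (delta * l) (delta * h) p p0 _ _ (node_neq z l Ezl) (fun k a => concentration_child z l k a Ezl).
- by rewrite dl0.
- by rewrite mulr_gt0 // ler_pM2l.
have q0 := clen_gt0 (t0 := T / 2) rule T0 k a : 0 < len k a.
have qE : len k a = pt k (a + 1) - pt k a by [].
pose x := (pt k a + pt k (a + 1)) / 2.
have big : cumul (z + 2 * l) - cumul (z - 2 * l) <= C * (mass k (a + 1) - mass k a).
  have := CP x (len k a / 2) ltac:(lra).
  have -> : x + len k a / 2 = pt k (a + 1) by rewrite /x qE; lra.
  have -> : x - len k a / 2 = pt k a by rewrite /x qE; lra.
  rewrite !(cumul_node (t0 := T / 2) rule T0); apply: le_trans.
  have : 3 * l <= 6 * K / delta * (len k a / 2).
    have -> : 6 * K / delta * (len k a / 2) = 3 * (K * len k a / delta) by field; rewrite gt_eqF.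
    rewrite ler_pM2l // ler_pdivlMr // (mulrC l) (mulrC K).
    by move: lo; rewrite -/K ler_pdivrMr.
  have : len k a <= l by apply: (le_trans hi); rewrite ler_piMl // ltW.
  by move=> h1 h2; apply: lerB; apply: (cumul_le (t0 := T / 2) rule T0); rewrite /x qE in h1 h2 *; lra.
have m0 : 0 <= mass k (a + 1) - mass k a by rewrite subr_ge0 ltW // (nmass_lt (t0 := T / 2) rule T0).
have w0 : 0 <= (K^-1) `^ p / C * (h / l) `^ p.
  by rewrite mulr_ge0 ?powR_ge0 // divr_ge0 ?powR_ge0 // ltW.
apply: (le_trans (ler_wpM2l w0 big)).
have -> : (K^-1) `^ p / C * (h / l) `^ p * (C * (mass k (a + 1) - mass k a)) =
    (K^-1 * (h / l)) `^ p * (mass k (a + 1) - mass k a).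
  rewrite [in RHS]powRM ?invr_ge0 ?divr_ge0 ?(ltW K0) ?(ltW h0) ?(ltW l0) //.
  by field; rewrite gt_eqF.
have -> : K^-1 * (h / l) = delta * h / (K * (delta * l)).
  by field; rewrite !gt_eqF.
apply: (le_trans hmass).
have dh : delta * h <= h by rewrite ler_piMl // ltW.
by apply: lerB; apply: (cumul_le (t0 := T / 2) rule T0); lra.
Qed.

End Concentration.

Lemma exists_concentrated_cumulative (R : realType) (E : R -> R -> Prop) (delta B p : R) :
  0 < delta -> delta <= 1 -> 0 < p -> 0 < B -> (forall z l, E z l -> 0 < l) ->
  (forall z l z' l', E z l -> E z' l' -> z <> z' -> 2 * delta * Num.min l l' <= `|z - z'|) ->
  (forall z l, E z l -> `|z| <= B /\ l <= B) ->
  exists F : cumulative R R, [/\ {homo F : x y / x < y},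
    exists2 C, 0 < C & forall x r : R, 0 < r ->
      F (x + 2 * r) - F (x - 2 * r) <= C * (F (x + r / 2) - F (x - r / 2))
  & exists2 c, 0 < c & forall z l h : R, E z l -> 0 < h <= l ->
      c * (h / l) `^ p * (F (z + 2 * l) - F (z - 2 * l)) <= F (z + h) - F (z - h)].
Proof.
move=> d0 d1 p0 B0 Epos Esep Ebnd.
(* Since [eta ^ p = 1 / 2], the bound [2 / M <= eta] gives [(2 / M) ^ p <= 1 / 2], and [10 <= M]
   gives [1 / 2 <= 1 - 5 / M]. *)
pose eta : R := 2^-1 `^ p^-1.
have eta0 : 0 < eta by rewrite powR_gt0.
have [M [M10 Md Me]] : exists M : nat, [/\ (10 <= M)%N, 1024 / delta < M%:R & 2 / eta < M%:R].
  have arch (x : R) : 0 <= x -> exists n : nat, x < n%:R.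
    by move=> x0; exists (Num.bound x); exact: archi_boundP.
  have [m1 h1] := arch (1024 / delta) (divr_ge0 (ler0n _ _) (ltW d0)).
  have [m2 h2] := arch (2 / eta) (divr_ge0 (ler0n _ _) (ltW eta0)).
  exists (10 + m1 + m2)%N; split; first by rewrite -addnA leq_addr.
    by apply: (lt_le_trans h1); rewrite ler_nat addnAC leq_addl.
  by apply: (lt_le_trans h2); rewrite ler_nat leq_addl.
have M0 : 0 < M%:R :> R by rewrite ltr0n; apply: leq_trans M10.
have Mdelta : 2 / M%:R < delta / 512.
  by move: Md; rewrite ltr_pdivrMr // => Md; rewrite ltr_pdivrMr //; lra.
have Mp : (2 / M%:R) `^ p <= 1 - 5 / M%:R.
  apply: (@le_trans _ _ 2^-1); last first.
    have : 10 <= M%:R :> R by rewrite (ler_nat R 10).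
    by rewrite lerBrDl -lerBrDr ler_pdivrMr //; lra.
  have -> : 2^-1 = eta `^ p :> R by rewrite -powRrM mulVf ?powRr1 ?gt_eqF.
  apply: ge0_ler_powR; rewrite ?nnegrE ?(ltW eta0) ?divr_ge0 ?(ltW p0) //.
  by move: Me; rewrite ltr_pdivrMr // ler_pdivrMr // => /ltW; rewrite mulrC.
have rule := concentration_rule d0 d1 Epos Esep M10.
have T0 : 0 < 4 * B by rewrite mulr_gt0.
pose F := @cumul R M (4 * B) (4 * B / 2) (@breakpoint R E delta M) (@massfun R E delta M).
have ndF : {homo F : x y / x <= y} by move=> x y; exact: (cumul_le rule T0).
have rcF : right_continuous F.
  move=> x; apply/cvgrPdist_le => e e0.
  have [d dpos hd] := cumul_right_cont (t0 := 4 * B / 2) rule T0 x e e0.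
  near=> y.
  have xy : x < y by near: y; exact: nbhs_right_gt.
  have yd : y < x + d by near: y; apply: nbhs_right_lt; rewrite ltrDl.
  rewrite distrC ger0_norm ?subr_ge0 ?ndF ?(ltW xy) //.
  by apply: hd; rewrite (ltW xy).
pose Fc : cumulative R R := HB.pack F (isCumulative.Build R _ _ F ndF rcF).
exists Fc; split.
- by move=> x y; exact: (cumul_lt rule T0).
- exact: (cumul_doubling rule T0).
- exact: (cumul_concentrated d0 d1 p0 Epos Esep Ebnd B0 M10 Mdelta Mp).
Unshelve. all: by end_near. Qed.

(** * Stieltjes outer measures *)

Section StieltjesOuterMeasure.
Context {R : realType} (F : cumulative R R).

Definition stieltjes_outer : {outer_measure set R -> \bar R} :=
  [the OuterMeasure.type R (ocitv_type R) of (wlength F)^*%mu].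

Lemma stieltjes_outerE (X : set R) : stieltjes_outer X = lebesgue_stieltjes_measure F X.
Proof. by []. Qed.

Lemma stieltjes_outer_itv (u v : R) : u <= v -> stieltjes_outer `]u, v]%classic = (F v - F u)%:E.
Proof.
move=> uv; rewrite stieltjes_outerE /lebesgue_stieltjes_measure.
rewrite /measure_extension measurable_mu_extE/=; last exact: is_ocitv.
by rewrite wlength_itv_bnd.
Qed.

(** A set of finite outer measure has covers by countably many half-open intervals with excess at
    most [1 / (n + 1)]; the intersection of their unions is the Borel hull. If the outer measure is
    infinite, the whole line serves. *)
Lemma stieltjes_outer_regular : borel_regular stieltjes_outer.
Proof.
split=> [A mA|A].
  exact: (@sub_caratheodory _ (ocitv_type R) R (wlength F) A mA).
case: (eqVneq (stieltjes_outer A) +oo%E) => [Aoo|Afin].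
  exists setT; split => //; rewrite Aoo; apply/esym/eqP.
  by rewrite -leye_eq -Aoo; apply: le_outer_measure.
have cover (n : nat) : exists B : set R, [/\ measurable B, A `<=` B &
    (stieltjes_outer B <= stieltjes_outer A + (n.+1%:R^-1)%:E)%E].
  have Afn : stieltjes_outer A \is a fin_num.
    by rewrite ge0_fin_numE ?outer_measure_ge0 // ltey.
  have e0 : 0 < n.+1%:R^-1 :> R by rewrite invr_gt0.
  have [_ [G [mG AG] <-] GA] := lb_ereal_inf_adherent e0 Afn.
  exists (\bigcup_k G k); split => //.
    by apply: bigcup_measurable => k _; apply: sub_sigma_algebra; exact: mG.
  apply: le_trans (ltW GA); apply: (le_trans (outer_measure_sigma_subadditive _ _)).
  apply: lee_nneseries => [k _ _|k _]; first exact: outer_measure_ge0.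
  by rewrite /stieltjes_outer /= measurable_mu_extE.
have [B BP] := choice cover.
exists (\bigcap_n B n); split.
- by apply: bigcap_measurable => // n _; case: (BP n).
- by move=> x Ax n _; case: (BP n) => _ + _; apply.
apply/eqP; rewrite eq_le; apply/andP; split.
  by apply: le_outer_measure => x Ax n _; case: (BP n) => _ + _; apply.
apply/lee_addgt0Pr => e e0.
pose n := Num.bound e^-1.
have [_ _ Bn] := BP n.
apply: (@le_trans _ _ (stieltjes_outer (B n))).
  by apply: le_outer_measure; exact: bigcap_inf.
apply: (le_trans Bn); apply: leeD => //; rewrite lee_fin.
rewrite -[leRHS]invrK lef_pV2 ?posrE ?invr_gt0 //.
have e1 : 0 < e^-1 by rewrite invr_gt0.
apply: (le_trans (ltW (archi_boundP (ltW e1)))).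
by rewrite ler_nat.
Qed.

(** An open ball of radius [s] lies between the half-open intervals of radii [s / 2] and [s]; this
    is why the hypothesis compares radii [2 * r] and [r / 2]. *)
Lemma stieltjes_outer_doubling C : {homo F : x y / x < y} -> 
  (forall x r : R, 0 < r -> F (x + 2 * r) - F (x - 2 * r) <= C * (F (x + r / 2) - F (x - r / 2))) ->
  doubling stieltjes_outer.
Proof.
move=> Flt FC; exists `|C| => x r r0.
have ballE (s : R) : ball x s = `]x - s, x + s[%classic by rewrite ball_itv.
have low (s : R) : 0 < s -> ((F (x + s / 2) - F (x - s / 2))%:E <= stieltjes_outer (ball x s))%E.
  move=> s0; rewrite -stieltjes_outer_itv; last by lra.
  apply: le_outer_measure; rewrite ballE; apply: subset_itv; rewrite bnd_simp; lra.
have up (s : R) : 0 < s -> (stieltjes_outer (ball x s) <= (F (x + s) - F (x - s))%:E)%E.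
  move=> s0; rewrite -stieltjes_outer_itv; last by lra.
  apply: le_outer_measure; rewrite ballE; apply: subset_itv; rewrite bnd_simp; lra.
have r20 : 0 < 2 * r by rewrite mulr_gt0.
split.
- apply: lt_le_trans (low _ r20); rewrite lte_fin subr_gt0; apply: Flt; lra.
- apply: (le_trans (up _ r20)).
  apply: (@le_trans _ _ (`|C|%:E * (F (x + r / 2) - F (x - r / 2))%:E)%E); last first.
    by apply: lee_wpmul2l => //; exact: low.
  rewrite -EFinM lee_fin; apply: (le_trans (FC x r r0)).
  by rewrite ler_wpM2r ?ler_norm // subr_ge0 ltW // Flt //; lra.
- apply: (@le_lt_trans _ _ (`|C|%:E * (F (x + r) - F (x - r))%:E)%E).
    by apply: lee_wpmul2l => //; exact: up.
  by rewrite -EFinM ltry.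
Qed.

End StieltjesOuterMeasure.

(** * Cantor constructions *)

Section CantorGeometry.
Context {R : realType} {idx : nat -> set nat} {a b c d : nat -> nat -> R}.
Hypothesis cantor : cantor_construction idx a b c d.

(** The midpoints between [x] and the ends of the open gap are still in the gap, hence in the closed
    interval, and lie strictly on either side of [x]. *)
Lemma gap_in_interior {n i} : idx n i -> Jint c d n i `<=` `]a n i, b n i[.
Proof.
move=> ni x /=; have [_ [_ [JI _]]] := cantor; rewrite /Jint /= in_itv /= => /andP[cx xd].
have inI y : c n i < y -> y < d n i -> a n i <= y <= b n i.
  by move=> cy yd; have /= := JI n i ni y; rewrite /Jint /Iint /= !in_itv /= cy yd => /(_ isT).
have := inI ((c n i + x) / 2) ltac:(lra) ltac:(lra).
have := inI ((x + d n i) / 2) ltac:(lra) ltac:(lra).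
by rewrite in_itv /= => h1 h2; apply/andP; split; lra.
Qed.

Lemma level_nested n n' : (n <= n')%N ->
  \bigcup_(i in idx n') Iint a b n' i `<=` \bigcup_(i in idx n) Iint a b n i.
Proof.
have [_ [_ [_ [_ [US _]]]]] := cantor.
move=> /subnKC <-; elim: (n' - n)%N => [|j IH]; first by rewrite addn0.
by rewrite addnS US => x [/IH].
Qed.

(** At equal levels the interiors are disjoint; at a later level the gap has already been
    removed. *)
Lemma gap_not_interior n n' i i' z : idx n i -> idx n' i' -> (n <= n')%N -> (n, i) <> (n', i') ->
  Jint c d n i z -> a n' i' < z < b n' i' -> False.
Proof.
move=> ni ni'; rewrite leq_eqVlt => /orP[/eqP nn|nn] neq Jz zI; have [_ [disj [_ [_ [US _]]]]] := cantor.
  subst n'; have ii : i <> i' by move=> ii; apply: neq; rewrite ii.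
  have : set0 z by rewrite -(disj n i i' ni ni' ii); split => //; exact: gap_in_interior ni _ Jz.
  by [].
have : (\bigcup_(i in idx n.+1) Iint a b n.+1 i) z.
  apply: (level_nested _ _ nn); exists i' => //; rewrite /Iint /= in_itv /=.
  by case/andP: zI => /ltW -> /ltW ->.
by rewrite US => -[_]; apply; exists i.
Qed.

(** The point of the earlier gap lies outside the interior of the later interval, while the other
    point is deep inside that interval. *)
Lemma gap_points_separated kap n i n' i' z z' : 0 < kap -> idx n i -> idx n' i' ->
  Jint c d n i z -> Jint c d n' i' z' ->
  a n i + 2 * kap * (b n i - a n i) <= z <= b n i - 2 * kap * (b n i - a n i) ->
  a n' i' + 2 * kap * (b n' i' - a n' i') <= z' <= b n' i' - 2 * kap * (b n' i' - a n' i') ->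
  (n, i) <> (n', i') ->
  2 * kap * Num.min (b n i - a n i) (b n' i' - a n' i') <= `|z - z'|.
Proof.
move=> k0; wlog nn : n i n' i' z z' / (n <= n')%N => [wl|] ni ni' Jz Jz' zI zI' neq.
  case: (leqP n n') => nn; first exact: wl.
  by rewrite distrC minC; apply: wl => //; [exact: ltnW | move=> e; apply: neq].
have out := gap_not_interior n n' i i' z ni ni' nn neq Jz.
have k20 : 0 <= 2 * kap by rewrite mulr_ge0 // ltW.
have : 2 * kap * Num.min (b n i - a n i) (b n' i' - a n' i') <= 2 * kap * (b n' i' - a n' i').
  by apply: ler_wpM2l => //; rewrite ge_min lexx orbT.
move/le_trans; apply; rewrite ler_normr.
case: (lerP z (a n' i')) => za; first by apply/orP; right; lra.
case: (lerP (b n' i') z) => zb; first by apply/orP; left; lra.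
by case: out; rewrite za zb.
Qed.

End CantorGeometry.

(** * Nullity of the Cantor set from the mass of the gaps *)

Section CantorNull.
Context {R : realType} (m : {measure set (measurableTypeR R) -> \bar R}) (idx : nat -> set nat)
  (a b c d : nat -> nat -> R) (alpha : nat -> R) (k p : R).

Let U n := \bigcup_(i in idx n) Iint a b n i.
Let V n := \bigcup_(i in idx n) Jint c d n i.

Hypothesis cantor : cantor_construction idx a b c d.
Hypotheses (k0 : 0 < k) (U0fin : (m (U 0%N) < +oo)%E).
Hypothesis mJ : forall n i, idx n i ->
  ((k * alpha n `^ p)%:E * m (Iint a b n i) <= m (Jint c d n i))%E.
Hypothesis asum : (\sum_(0 <= n <oo) ((alpha n `^ p)%:E) = +oo)%E.

Let measurable_U n : measurable (U n).
Proof. by apply: bigcup_measurable => i _; exact: measurable_itv. Qed.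

Let measurable_V n : measurable (V n).
Proof. by apply: bigcup_measurable => i _; exact: measurable_itv. Qed.

Let trivIset_gap n : trivIset (idx n) (Jint c d n).
Proof.
apply/trivIsetP => i j ni nj nij; have ij : i <> j by exact/eqP.
rewrite -subset0 => x [/(gap_in_interior cantor ni) xi].
move=> /(gap_in_interior cantor nj) xj; have [_ [disj _]] := cantor.
by rewrite -(disj n i j ni nj ij).
Qed.

Let measure_gaps n : ((k * alpha n `^ p)%:E * m (U n) <= m (V n))%E.
Proof.
have -> : m (V n) = (\sum_(i <oo | i \in idx n) m (Jint c d n i))%E.
  by apply: measure_bigcup => [i _|]; [exact: measurable_itv | exact: trivIset_gap].
apply: (@le_trans _ _ ((k * alpha n `^ p)%:E * \sum_(i <oo | i \in idx n) m (Iint a b n i))%E).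
  apply: lee_wpmul2l; first by rewrite lee_fin mulr_ge0 ?powR_ge0 // ltW.
  pose I' i := if i \in idx n then Iint a b n i else set0.
  have -> : (\sum_(i <oo | i \in idx n) m (Iint a b n i) = \sum_(i <oo) m (I' i))%E.
    rewrite eseries_mkcond; apply: eq_eseriesr => i _; rewrite /I'.
    by case: ifP => // _; rewrite measure0.
  apply: measure_sigma_subadditive => [i| |x [i ni xi]].
  - by rewrite /I'; case: ifP => // _; exact: measurable_itv.
  - exact: measurable_U.
  - by exists i => //; rewrite /I' mem_set.
rewrite -nneseriesZl; last by move=> i _; exact: measure_ge0.
apply: lee_nneseries => i.
  by move=> _ _; apply: mule_ge0 => //; rewrite lee_fin mulr_ge0 ?powR_ge0 // ltW.
by rewrite inE => ni; exact: mJ.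
Qed.

Let V_sub_U n : V n `<=` U n.
Proof. by have [_ [_ [JI _]]] := cantor; move=> x [i ni xi]; exists i => //; exact: JI. Qed.

Let measure_U_split n : m (U n) = (m (V n) + m (U n.+1))%E.
Proof.
have [_ [_ [_ [_ [US _]]]]] := cantor.
have mD : measurable (U n `\` V n) by exact: measurableD.
have dis : V n `&` (U n `\` V n) = set0 by rewrite setDE setICA setICr setI0.
rewrite [X in (_ = _ + m X)%E](_ : _ = U n `\` V n); last exact: US.
by rewrite -(measureU m (measurable_V n) mD dis) setDUK //; exact: V_sub_U.
Qed.

(** Step [n] removes mass at least [k * alpha n ^ p * m (U n)], hence at least
    [k * alpha n ^ p * m K]. These losses add up to at most the finite [m (U 0)], so a positive
    [m K] would bound the divergent series. *)
Lemma measure_cantor_set : m (cantor_set idx a b) = 0%E.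
Proof.
set K := cantor_set idx a b.
have mK : measurable K by apply: bigcap_measurable => // n _; exact: measurable_U.
have KU n : K `<=` U n by move=> x Kx; exact: Kx n I.
have mKU n : (m K <= m (U n))%E.
  by apply: le_measure; [exact: mem_set | apply: mem_set; exact: measurable_U | exact: KU].
apply/eqP; rewrite eq_le measure_ge0 andbT leNgt; apply/negP => K0.
have Kfin : m K \is a fin_num.
  rewrite ge0_fin_numE ?measure_ge0 //; apply: le_lt_trans U0fin.
  exact: mKU.
have Ufin : m (U 0%N) \is a fin_num by rewrite ge0_fin_numE ?measure_ge0.
have partial N : ((k * \sum_(0 <= n < N) alpha n `^ p)%:E * m K + m (U N) <= m (U 0%N))%E.
  elim: N => [|N IH]; first by rewrite big_nil mulr0 mul0e add0e.
  have S0 : (0 <= (k * \sum_(0 <= n < N) alpha n `^ p)%:E)%E.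
    by rewrite lee_fin mulr_ge0 ?(ltW k0) // sumr_ge0 // => n _; exact: powR_ge0.
  have a0 : (0 <= (k * alpha N `^ p)%:E)%E by rewrite lee_fin mulr_ge0 ?powR_ge0 // ltW.
  apply: le_trans IH; rewrite big_nat_recr //= mulrDr EFinD ge0_muleDl //.
  rewrite -addeA; apply: leeD => //; rewrite (measure_U_split N); apply: leeD => //.
  apply: le_trans (measure_gaps N); apply: lee_wpmul2l.
    by rewrite lee_fin mulr_ge0 ?powR_ge0 // ltW.
  exact: mKU.
have kK0 : 0 < k * fine (m K) by rewrite mulr_gt0 // fine_gt0 // K0 ltey_eq Kfin.
have bound N : \sum_(0 <= n < N) alpha n `^ p <= fine (m (U 0%N)) / (k * fine (m K)).
  rewrite ler_pdivlMr // -lee_fin (fineK Ufin); apply: le_trans (partial N).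
  rewrite -[X in (X <= _)%E]adde0; apply: leeD; last exact: measure_ge0.
  by rewrite -[m K](fineK Kfin) -EFinM lee_fin mulrA (mulrC k).
have : (+oo <= (fine (m (U 0%N)) / (k * fine (m K)))%:E)%E.
  rewrite -asum; apply: lime_le.
    by apply: is_cvg_nneseries => n _ _; rewrite lee_fin powR_ge0.
  by apply: nearW => N; rewrite sumEFin lee_fin; exact: bound.
by rewrite leNgt ltry.
Qed.

End CantorNull.

(** * Choice of the points and construction of the measure *)

(** Niceness gives [y] in the gap at distance at least [4 * kap * (b - a)] from the ends of the
    interval. Moving it by [kap * (d - c)] towards the middle of the gap costs at most
    [kap * (b - a)] of this margin. *)
Lemma exists_central_gap_point (R : realType) (a b c d s y kap : R) :
  kap = (1 - s) / 8 -> 0 < s < 1 -> a <= c -> c < d -> d <= b -> c < y < d ->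
  (a + b) / 2 - s * (b - a) / 2 <= y <= (a + b) / 2 + s * (b - a) / 2 ->
  exists z, c + kap * (d - c) <= z <= d - kap * (d - c) /\
    a + 2 * kap * (b - a) <= z <= b - 2 * kap * (b - a).
Proof.
move=> kapE s01 ac cd db cyd yI.
have k0 : 0 < kap by rewrite kapE; lra.
have h1 : kap * (d - c) <= kap * (b - a) by rewrite ler_pM2l //; lra.
have h2 : kap * (d - c) <= (d - c) / 8.
  by rewrite mulrC ler_pM2l ?subr_gt0 // kapE; lra.
have sE : s * (b - a) = (b - a) - 8 * (kap * (b - a)) by rewrite kapE; field.
have k3 : 0 < kap * (d - c) by rewrite mulr_gt0 // subr_gt0.
have -> : 2 * kap * (b - a) = 2 * (kap * (b - a)) by ring.
rewrite sE in yI.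
case: (lerP y ((c + d) / 2)) => yc.
  by exists (y + kap * (d - c)); split; apply/andP; split; lra.
by exists (y - kap * (d - c)); split; apply/andP; split; lra.
Qed.

Theorem theorem2p1 (R : realType) (idx : nat -> set nat)
    (a b c d : nat -> nat -> R) (alpha : nat -> R) (p : R) :
  cantor_construction idx a b c d ->
  nice_construction idx a b c d ->
  porous_construction alpha idx a b c d ->
  (forall n, 0 < alpha n < 1) ->
  0 < p ->
  (\sum_(0 <= n <oo) ((alpha n `^ p)%:E) = +oo)%E ->
  exists mu : {outer_measure set R -> \bar R},
    [/\ borel_regular mu, doubling mu & mu (cantor_set idx a b) = 0%E].
Proof.
move=> cantor [s [s01 nice]] porous alpha01 p0 asum.
have [_ [_ [JI [_ [_ [_ [M0 M0P]]]]]]] := cantor.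
have [kap kapE] : exists kap, kap = (1 - s) / 8 by exists ((1 - s) / 8).
have k0 : 0 < kap by rewrite kapE; lra.
have k1 : kap <= 1 by rewrite kapE; lra.
have gapP n i : idx n i -> [/\ a n i <= c n i, c n i < d n i & d n i <= b n i].
  move=> ni; have [y [_]] := nice n i ni; rewrite /Jint /= in_itv /= => /andP[cy yd].
  have inI w : c n i < w -> w < d n i -> a n i < w < b n i.
    move=> cw wd; have := gap_in_interior cantor ni w.
    by rewrite /Jint /= !in_itv /= cw wd => /(_ isT).
  split; last 2 first.
  - exact: lt_trans cy yd.
  (* Otherwise the larger of [y] and the right end of the interval would be in the gap without being
     interior to the interval. *)
  - rewrite leNgt; apply/negP => bd.
    have /andP[_] : a n i < Num.max y (b n i) < b n i.
      by apply: inI; rewrite ?lt_max ?gt_max ?cy ?yd ?bd.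
    by rewrite gt_max ltxx andbF.
  - rewrite leNgt; apply/negP => ca.
    have /andP[+ _] : a n i < Num.min y (a n i) < b n i.
      by apply: inI; rewrite ?lt_min ?gt_min ?cy ?yd ?ca.
    by rewrite lt_min ltxx andbF.
have zex n i : exists z, idx n i ->
    c n i + kap * (d n i - c n i) <= z <= d n i - kap * (d n i - c n i) /\
    a n i + 2 * kap * (b n i - a n i) <= z <= b n i - 2 * kap * (b n i - a n i).
  case: (pselect (idx n i)) => [ni|//]; last by exists 0.
  have [ac cd db] := gapP n i ni; have [y [yI]] := nice n i ni.
  move: yI; rewrite /concentric_scale /Jint /= !in_itv /= => yI yJ.
  have [z zP] := exists_central_gap_point R _ _ _ _ s y kap kapE s01 ac cd db yJ yI.
  by exists z.
have [zf zP] : exists zf : nat -> nat -> R, forall n i, idx n i ->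
    c n i + kap * (d n i - c n i) <= zf n i <= d n i - kap * (d n i - c n i) /\
    a n i + 2 * kap * (b n i - a n i) <= zf n i <= b n i - 2 * kap * (b n i - a n i).
  by exists (fun n i => projT1 (cid (zex n i))) => n i; exact: projT2 (cid (zex n i)).
have zJ n i : idx n i -> Jint c d n i (zf n i).
  move=> ni; have [_ cd _] := gapP n i ni; have [h _] := zP n i ni.
  have : 0 < kap * (d n i - c n i) by rewrite mulr_gt0 // subr_gt0.
  by rewrite /Jint /= in_itv /= => h'; apply/andP; split; lra.
pose E z l := exists n i, [/\ idx n i, z = zf n i & l = b n i - a n i].
have lpos n i : idx n i -> 0 < b n i - a n i.
  by move=> ni; have [ac cd db] := gapP n i ni; lra.
(* Lengths are at most [2 * M0]; adding [1] makes the bound positive even if the construction is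
   empty. *)
pose B := 2 * `|M0| + 1; have B0 : 0 < B by rewrite ltr_wpDl // mulr_ge0.
have inB n i x : idx n i -> a n i <= x <= b n i -> `|x| <= M0.
  move=> ni xI; have [//|j j0 xj] := level_nested cantor 0 n (leq0n n) x.
    by exists i => //; rewrite /Iint /= in_itv.
  exact: (M0P j).
have [F [Flt [C C0 FC] [q q0 Fq]]] : exists F : cumulative R R, [/\ {homo F : x y / x < y},
    exists2 C, 0 < C & forall x r : R, 0 < r ->
      F (x + 2 * r) - F (x - 2 * r) <= C * (F (x + r / 2) - F (x - r / 2))
  & exists2 c, 0 < c & forall z l h : R, E z l -> 0 < h <= l ->
      c * (h / l) `^ p * (F (z + 2 * l) - F (z - 2 * l)) <= F (z + h) - F (z - h)].
  apply: (exists_concentrated_cumulative R E kap B p) => //.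
  - by move=> z l [n [i [ni _ ->]]]; exact: lpos.
  - move=> z l z' l' [n [i [ni -> ->]]] [n' [i' [ni' -> ->]]] zz'.
    apply: (gap_points_separated cantor) => //; try exact: zJ.
    + by have [] := zP n i ni.
    + by have [] := zP n' i' ni'.
    + by case=> nn ii; apply: zz'; rewrite nn ii.
  - move=> z l [n [i [ni -> ->]]].
    have aB := inB n i (a n i) ni; have bB := inB n i (b n i) ni.
    have [_ zI] := zP n i ni; have l0 := lpos n i ni.
    have kl : 0 < 2 * kap * (b n i - a n i) by apply: mulr_gt0 => //; exact: mulr_gt0.
    have {}aB : `|a n i| <= M0 by apply: aB; apply/andP; split; lra.
    have {}bB : `|b n i| <= M0 by apply: bB; apply/andP; split; lra.
    have zB : `|zf n i| <= M0 by apply: (inB n i _ ni); apply/andP; split; lra.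
    have M00 : `|M0| = M0 by apply: ger0_norm; apply: le_trans zB.
    rewrite ler_norml in aB; rewrite ler_norml in bB; rewrite /B M00.
    have := normr_ge0 (zf n i); split; lra.
have Fle : {homo F : x y / x <= y} by exact: cumulative_is_nondecreasing.
exists (stieltjes_outer F); split.
- exact: stieltjes_outer_regular.
- exact: (stieltjes_outer_doubling F C).
- rewrite stieltjes_outerE.
  apply: (measure_cantor_set (lebesgue_stieltjes_measure F) idx a b c d alpha
    (q * (kap / 2) `^ p) p cantor) => //.
  + by rewrite mulr_gt0 // powR_gt0 // divr_gt0.
  (* The left end is shifted by [1] because the half-open interval must contain the point [- M0]. *)
  + apply: (@le_lt_trans _ _ (F `|M0| - F (- `|M0| - 1))%:E); last exact: ltry.
    rewrite -(stieltjes_outer_itv F); last by have := normr_ge0 M0; lra.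
    change (stieltjes_outer F (\bigcup_(i in idx 0%N) Iint a b 0 i) <=
      stieltjes_outer F `](- `|M0| - 1)%R, `|M0|%R]%classic)%E.
    apply: le_outer_measure => x [i i0 xi].
    have := M0P i x i0 xi; have := ler_norm M0; rewrite /= in_itv /= ler_norml.
    by move=> h1 h2; apply/andP; split; lra.
  + move=> n i ni.
    change ((q * (kap / 2) `^ p * alpha n `^ p)%R%:E * stieltjes_outer F (Iint a b n i) <=
      stieltjes_outer F (Jint c d n i))%E.
    have l0 := lpos n i ni; have /andP[al0 al1] := alpha01 n.
    have [ac cd db] := gapP n i ni; have [zJ' zI] := zP n i ni.
    set l := b n i - a n i in l0 *; set z := zf n i in zJ' zI *.
    (* By porosity [h] is at most half of [kap * (d - c)], the distance from [z] to the ends of the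
       gap, so the gap contains the interval of radius [h]; and [h / l] is [alpha n] up to a
       constant. *)
    pose h := kap / 2 * alpha n * l.
    have kl : 0 < 2 * kap * l by apply: mulr_gt0 => //; exact: mulr_gt0.
    have h0 : 0 < h by rewrite /h !mulr_gt0 ?divr_gt0.
    have hJ : h <= kap * (d n i - c n i) / 2.
      have := ler_wpM2l (ltW k0) (porous n i ni); rewrite /h -/l; lra.
    have hl : h <= l.
      have : kap * (d n i - c n i) <= d n i - c n i by rewrite ler_piMl // subr_ge0 ltW.
      rewrite /l; lra.
    have hJ0 : 0 < kap * (d n i - c n i) by rewrite mulr_gt0 // subr_gt0.
    have Ez : E z l by exists n, i.
    have := Fq z l h Ez; rewrite h0 hl => /(_ isT) main.
    have hE : h / l = kap / 2 * alpha n by rewrite /h mulfK // gt_eqF.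
    apply: (@le_trans _ _ (stieltjes_outer F `]z - h, z + h]%classic)); last first.
      apply: le_outer_measure => x; rewrite /Jint /= !in_itv /= => xz.
      by apply/andP; split; lra.
    apply: (@le_trans _ _ ((q * (kap / 2) `^ p * alpha n `^ p)%R%:E *
        stieltjes_outer F `](z - 2 * l)%R, (z + 2 * l)%R]%classic)%E).
      apply: lee_wpmul2l; first by rewrite lee_fin !mulr_ge0 ?powR_ge0 // ltW.
      apply: le_outer_measure => x; rewrite /Iint /= !in_itv /= => xI.
      by rewrite /l in kl zI *; apply/andP; split; lra.
    rewrite !stieltjes_outer_itv; [|lra|lra].
    rewrite -EFinM lee_fin; apply: le_trans main.
    have -> : (h / l) `^ p = (kap / 2) `^ p * alpha n `^ p.
      by rewrite hE powRM ?divr_ge0 ?(ltW k0) ?(ltW al0).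
    by rewrite mulrA.
Qed.
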